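(* Let $G$ be a fixed connected unimodular graph such that $c:=\sum_i|\mathrm{Stab}(o_i)|^{-1}<\infty$, where $\{o_i\}$ is a complete section of the orbits of $\mathrm{Aut}(G)$ on $V(G)$. Let $\nu$ be an $\mathrm{Aut}(G)$-invariant probability measure on unrooted networks whose underlying graph is $G$. Then randomly rooting the network by taking the root to be $o_i$ with probability $c^{-1}|\mathrm{Stab}(o_i)|^{-1}$ (independently of the network) gives a unimodular probability measure $\mu$ on $\mathcal{G}_*$. Conversely, let $\mu$ be a unimodular probability measure on $\mathcal{G}_*$ supported on networks whose underlying graph is $G$. Then the measure $\lambda_\mu$ (defined in the context) on unrooted networks on $G$ is $\mathrm{Aut}(G)$-invariant.
   Context: A network is a (multi-)graph with a complete separable metric space $\Xi$ of marks, a mark in $\Xi$ at each vertex, and two marks in $\Xi$ on each edge, one associated to each of its endpoints. $\mathcal{G}_*$ is the set of rooted-isomorphism classes $[\overline G,o]$ of rooted connected locally finite networks $(\overline G,o)$, with the local topology (two rooted networks are close if large balls around their roots are isomorphic as rooted graphs with corresponding marks close). $\mathcal{G}_{**}$ is the analogous space for networks with an ordered pair of distinguished vertices. A Borel probability measure $\mu$ on $\mathcal{G}_*$ is unimodular if for all Borel $f:\mathcal{G}_{**}\to[0,\infty]$, $\int\sum_{x} f(\overline G,o,x)\,d\mu=\int\sum_x f(\overline G,x,o)\,d\mu$, the sums being over the vertices. $\mathrm{Aut}(G)$ has the weak topology generated by its action on $G$; $\mathrm{Stab}(x)$ is the stabilizer of the vertex $x$ (compact and open); $|\cdot|$ is Haar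 measure on $\mathrm{Aut}(G)$; $G$ is unimodular if $\mathrm{Aut}(G)$ is a unimodular group. Definition of $\lambda_\mu$. For a graph $G'$ and $x\in V(G')$, $z\in V(G)$, let $\Phi(x,z)$ be the set of rooted isomorphisms (if any) from $(G',x)$ to $(G,z)$. When nonempty, it carries a natural probability measure $\lambda'_{(G',x;z)}$ arising from the Haar probability measure on $\mathrm{Stab}(z)$ (push it forward under $\gamma\mapsto\gamma\circ\phi_0$ for any $\phi_0\in\Phi(x,z)$); when $\Phi(x,z)=\emptyset$, let $\lambda'_{(G',x;z)}:=0$. Put $\lambda_{(G',x)}:=\sum_{z\in V(G)}\lambda'_{(G',x;z)}$. For $G'$ isomorphic to $G$ and $x\in V(G')$, let $\tau(G',x):=o_i$ for the unique $o_i$ with $\Phi(x,o_i)\neq\emptyset$. For $\mu$ concentrated on classes of networks $\overline G'$ whose underlying graph $G'$ is (isomorphic to) $G$, define for Borel sets $\mathcal{A}$ of networks on $G$ $$\lambda_\mu(\mathcal{A}) := \int\int_{\Phi(o,\tau(G',o))} \mathbf{1}_{\mathcal{A}}(\phi\overline G')\,d\lambda_{(G',o)}(\phi)\,d\mu([\overline G',o]),$$ where $\phi\overline G'$ is the network on $G$ obtained by transporting the marks of $\overline G'$ by $\phi$. *)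

(* Defs.v *)
From HB Require Import structures.
From mathcomp Require Import all_boot all_order all_algebra.
From mathcomp Require Import all_classical all_reals all_analysis measurable_realfun.

Set Implicit Arguments.
Unset Strict Implicit.
Unset Printing Implicit Defensive.

Import Order.TTheory GRing.Theory Num.Theory.

Local Open Scope classical_set_scope.
Local Open Scope ring_scope.

(* Complete metric spaces; the library has no join of [metricType] and
   [completePseudoMetricType]. *)
#[short(type="completeMetricType")]
HB.structure Definition CompleteMetric (R : numDomainType) :=
  {T of Metric R T & Complete T}.

Definition separable (T : topologicalType) : Prop :=
  exists2 A : set T, countable A & dense A.

Notation borel T := (g_sigma_algebraType (@open T)).

(* Serre's encoding: every edge consists of two opposite darts (half-edges),
   exchanged by the fixed-point-free involution [rev]; a dart stands for its
   edge together with the endpoint [origin] at which it is attached.  Multiple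
   edges and loops are allowed, and the two ends of a loop are distinct darts. *)
Record multigraph := Multigraph {
  vertex : Type;
  dart : Type;
  origin : dart -> vertex;
  rev : dart -> dart;
  revK : involutive rev;
  rev_neq : forall d, rev d <> d }.

HB.instance Definition _ (G : multigraph) := gen_eqMixin (vertex G).
HB.instance Definition _ (G : multigraph) := gen_choiceMixin (vertex G).
HB.instance Definition _ (G : multigraph) := gen_eqMixin (dart G).
HB.instance Definition _ (G : multigraph) := gen_choiceMixin (dart G).

(* Vertices at graph distance at most [r] from the set [C]. *)
Fixpoint gball (G : multigraph) (C : set (vertex G)) (r : nat) :
    set (vertex G) :=
  if r is s.+1 then
    gball C s `|`
    [set origin (rev d) | d in [set d : dart G | gball C s (origin d)]]
  else C.

Definition connected_graph (G : multigraph) : Prop :=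
  forall x y : vertex G, exists r, gball [set x] r y.

Definition locally_finite (G : multigraph) : Prop :=
  forall x : vertex G, finite_set [set d : dart G | origin d = x].

Record graph := Graph {
  graph_multigraph :> multigraph;
  graph_inhabited : inhabited (vertex graph_multigraph);
  graph_connected : connected_graph graph_multigraph;
  graph_locally_finite : locally_finite graph_multigraph }.

(* The inverse maps are part of the data, but determined by the others. *)
Record iso (G H : multigraph) := Iso {
  isoV : vertex G -> vertex H;
  isoD : dart G -> dart H;
  isoV_inv : vertex H -> vertex G;
  isoD_inv : dart H -> dart G;
  isoVK : cancel isoV isoV_inv;
  isoV_invK : cancel isoV_inv isoV;
  isoDK : cancel isoD isoD_inv;
  isoD_invK : cancel isoD_inv isoD;
  iso_origin : forall d, origin (isoD d) = isoV (origin d);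
  iso_rev : forall d, rev (isoD d) = isoD (rev d) }.

Definition iso_id (G : multigraph) : iso G G.
Proof. by exists id id id id. Defined.

Definition iso_comp (G H K : multigraph) (g : iso H K) (f : iso G H) : iso G K.
Proof.
exists (isoV g \o isoV f) (isoD g \o isoD f)
  (isoV_inv f \o isoV_inv g) (isoD_inv f \o isoD_inv g).
- by move=> x /=; rewrite !isoVK.
- by move=> x /=; rewrite !isoV_invK.
- by move=> x /=; rewrite !isoDK.
- by move=> x /=; rewrite !isoD_invK.
- by move=> d /=; rewrite !iso_origin.
- by move=> d /=; rewrite !iso_rev.
Defined.

Definition iso_inv (G H : multigraph) (f : iso G H) : iso H G.
Proof.
exists (isoV_inv f) (isoD_inv f) (isoV f) (isoD f).
- exact: isoV_invK.
- exact: isoVK.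
- exact: isoD_invK.
- exact: isoDK.
- by move=> d; rewrite -{2}(isoD_invK f d) iso_origin isoVK.
- by move=> d; rewrite -{2}(isoD_invK f d) iso_rev isoDK.
Defined.

Definition aut (G : multigraph) := iso G G.

(* The topology of pointwise convergence on vertices and darts, both sets being
   discrete: the weak topology generated by the action of [aut G] on [G]. *)
Definition aut_open (G : multigraph) (U : set (aut G)) : Prop :=
  forall f, U f -> exists (A : set (vertex G)) (B : set (dart G)),
    [/\ finite_set A, finite_set B &
        forall g : aut G, {in A, isoV g =1 isoV f} ->
          {in B, isoD g =1 isoD f} -> U g].

HB.instance Definition _ (G : multigraph) := gen_eqMixin (aut G).
HB.instance Definition _ (G : multigraph) := gen_choiceMixin (aut G).
HB.instance Definition _ (G : multigraph) := isPointed.Build (aut G) (iso_id G).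

Section aut_topology.
Variable G : multigraph.

Lemma aut_openT : @aut_open G setT.
Proof. by move=> f _; exists set0, set0; split => //; exact: finite_set0. Qed.

Lemma aut_openI : setI_closed (@aut_open G).
Proof.
move=> U V oU oV f [/oU[A [B [fA fB hU]]] /oV[A' [B' [fA' fB' hV]]]].
exists (A `|` A'), (B `|` B'); split; rewrite ?finite_setU//.
move=> g hA hB; split.
- by apply: hU => x xA; [apply: hA|apply: hB]; rewrite in_setU xA.
- by apply: hV => x xA; [apply: hA|apply: hB]; rewrite in_setU xA orbT.
Qed.

Lemma aut_open_bigU (I : Type) (F : I -> set (aut G)) :
  (forall i, aut_open (F i)) -> aut_open (\bigcup_i F i).
Proof.
move=> oF f [i _ /oF[A [B [fA fB h]]]]; exists A, B; split=> // g hA hB.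
by exists i => //; exact: h.
Qed.

HB.instance Definition _ := @isOpenTopological.Build (aut G)
  (@aut_open G) aut_openT aut_openI aut_open_bigU.

End aut_topology.

Definition stab (G : multigraph) (x : vertex G) : set (aut G) :=
  [set g | isoV g x = x].

Definition complete_section (G : multigraph) (S : set (vertex G)) : Prop :=
  forall x, exists! o, S o /\ exists g : aut G, isoV g x = o.

Section haar.
Variables (R : realType) (G : graph).
Implicit Type m : {measure set (borel (aut G)) -> \bar R}.
Local Open Scope ereal_scope.

(* Left Haar measure.  As [G] is countable, [aut G] is second countable and
   locally compact, so regularity need not be required. *)
Definition is_haar m : Prop :=
  [/\ m setT != 0,
      forall K : set (aut G), compact K -> m K < +oo &
      forall (g : aut G) (A : set (borel (aut G))), measurable A ->
        m [set iso_comp g h | h in A] = m A].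

Definition right_invariant m : Prop :=
  forall (g : aut G) (A : set (borel (aut G))), measurable A ->
    m [set iso_comp h g | h in A] = m A.

End haar.

Definition unimodular_graph (R : realType) (G : graph) : Prop :=
  forall m : {measure set (borel (aut G)) -> \bar R},
    is_haar m -> right_invariant m.

(* Marks on the vertices and on the darts, i.e. two marks on every edge, one
   for each of its endpoints; topologized as a product. *)
Definition marking (Xi : Type) (G : multigraph) : Type :=
  ({ptws vertex G -> Xi} * {ptws dart G -> Xi})%type.

HB.instance Definition _ (Xi : topologicalType) (G : multigraph) :=
  Topological.copy (marking Xi G)
    ({ptws vertex G -> Xi} * {ptws dart G -> Xi})%type.
HB.instance Definition _ (Xi : ptopologicalType) (G : multigraph) :=
  isPointed.Build (marking Xi G) (fun=> point, fun=> point).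

Definition vmark (Xi : Type) (G : multigraph) (w : marking Xi G)
  : vertex G -> Xi := w.1.
Definition dmark (Xi : Type) (G : multigraph) (w : marking Xi G)
  : dart G -> Xi := w.2.

Definition transport (Xi : Type) (G H : multigraph) (f : iso G H)
    (w : marking Xi G) : marking Xi H :=
  (vmark w \o isoV_inv f, dmark w \o isoD_inv f).

Definition aut_invariant (R : realType) (Xi : ptopologicalType) (G : graph)
    (nu : set (borel (marking Xi G)) -> \bar R) : Prop :=
  forall (g : aut G) (A : set (borel (marking Xi G))), measurable A ->
    nu (transport g @^-1` A) = nu A.

Record rooted_network (Xi : Type) (k : nat) := RootedNetwork {
  ngraph : graph;
  nmark : marking Xi ngraph;
  nroots : k.-tuple (vertex ngraph) }.

Definition network_iso (Xi : Type) (k : nat) (N M : rooted_network Xi k) :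
    Prop :=
  exists f : iso (ngraph N) (ngraph M),
    transport f (nmark N) = nmark M /\
    map_tuple (isoV f) (nroots N) = nroots M.

Section local_topology.
Context {R : realType} {Xi : completeMetricType R} {k : nat}.
Implicit Types (N M : rooted_network Xi k) (r : nat) (e : R).

HB.instance Definition _ := gen_eqMixin (rooted_network Xi k).
HB.instance Definition _ := gen_choiceMixin (rooted_network Xi k).

Definition vball N r : set (vertex (ngraph N)) :=
  gball (range (tnth (nroots N))) r.
Arguments vball : clear implicits.

Definition dball N r : set (dart (ngraph N)) :=
  [set d | vball N r (origin d) /\ vball N r (origin (rev d))].
Arguments dball : clear implicits.

(* The balls of radius [r] around the roots are isomorphic as rooted graphs,
   with corresponding marks at distance less than [e].  For two roots the ball
   is the union of the balls around each of them. *)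
Definition locally_close r e N M : Prop :=
  exists (fV : vertex (ngraph N) -> vertex (ngraph M))
         (fD : dart (ngraph N) -> dart (ngraph M)),
    [/\ set_bij (vball N r) (vball M r) fV
          /\ set_bij (dball N r) (dball M r) fD,
        forall d, dball N r d ->
          origin (fD d) = fV (origin d) /\ rev (fD d) = fD (rev d),
        map_tuple fV (nroots N) = nroots M,
        forall x, vball N r x ->
          mdist (vmark (nmark N) x) (vmark (nmark M) (fV x)) < e &
        forall d, dball N r d ->
          mdist (dmark (nmark N) d) (dmark (nmark M) (fD d)) < e].

Definition network_open (U : set (rooted_network Xi k)) : Prop :=
  forall N, U N -> exists r e,
    0 < e /\ forall M, locally_close r e N M -> U M.

Lemma gballS (G : multigraph) (C : set (vertex G)) r s :
  (r <= s)%N -> gball C r `<=` gball C s.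
Proof.
elim: s => [|s IH]; first by rewrite leqn0 => /eqP ->.
rewrite leq_eqVlt => /predU1P[-> //|]; rewrite ltnS => /IH h x /h xs.
by left.
Qed.

Lemma vball_succ N r : vball N r.+1 = vball N r `|`
  [set origin (rev d) | d in [set d | vball N r (origin d)]].
Proof. by []. Qed.

Lemma dballS N r s : (r <= s)%N -> dball N r `<=` dball N s.
Proof. by move=> rs d [h1 h2]; split; apply: (gballS rs). Qed.

Lemma dball_rev N r d : dball N r d -> dball N r (rev d).
Proof. by move=> [h1 h2]; split => //; rewrite revK. Qed.

Lemma locally_closeW r s e e' N M : (r <= s)%N -> e <= e' ->
  locally_close s e N M -> locally_close r e' N M.
Proof.
move=> rs ee' [fV [fD [[bV bD] hD hR mV mD]]].
have [fV1 iV sV] := bV; have [fD1 iD sD] := bD.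
have sub t : (t <= s)%N -> fV @` vball N t = vball M t.
  elim: t => [_|t IH ts].
    rewrite /vball /= -hR; apply/seteqP; split.
      by move=> _ [_ [i _ <-] <-]; exists i => //; rewrite tnth_map.
    move=> _ [i _ <-]; rewrite tnth_map; exists (tnth (nroots N) i) => //.
  have {}IH := IH (ltnW ts).
  have step P d : vball P t (origin d) -> vball P t.+1 (origin (rev d)).
    by rewrite vball_succ => dt; right; exists d.
  have dP P d : vball P t (origin d) -> dball P s d.
    move=> dt; split; first exact: gballS (ltnW ts) _ dt.
    exact: gballS ts _ (step _ _ dt).
  apply/seteqP; split.
    move=> _ [x + <-]; rewrite 2!vball_succ => -[xt|[d /= dt <-]].
      by left; rewrite -IH; exists x.
    have ds := dP _ _ dt.
    right; exists (fD d) => /=.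
      by rewrite (hD _ ds).1 -IH; exists (origin d).
    by rewrite (hD _ ds).2 (hD _ (dball_rev ds)).1.
  move=> y; rewrite 2!vball_succ => -[|[d' /= d't <-]].
    by rewrite -IH => -[x xt <-]; exists x => //; left.
  have [d ds dd'] := sD _ (dP _ _ d't).
  move: d't; rewrite -IH -dd' (hD _ ds).1 => -[x xt fx].
  have {}fx : x = origin d.
    by apply: iV => //; rewrite inE; [exact: gballS (ltnW ts) _ xt|exact: ds.1].
  exists (origin (rev d)).
    by right; exists d => //=; rewrite -fx.
  by rewrite -(hD _ (dball_rev ds)).1 -(hD _ ds).2.
have Vr := sub _ rs.
exists fV, fD; split => //.
- split; split.
  + by move=> x xr; rewrite -Vr; exists x.
  + by move=> x y; rewrite !inE => xr yr; apply: iV;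
      rewrite inE; exact: gballS rs _ _.
  + by move=> y; rewrite -Vr.
  + move=> d dr; have ds := dballS rs dr; split.
      by rewrite (hD _ ds).1 -Vr; exists (origin d) => //; exact: dr.1.
    rewrite (hD _ ds).2 (hD _ (dball_rev ds)).1 -Vr.
    by exists (origin (rev d)) => //; exact: dr.2.
  + by move=> x y; rewrite !inE => xr yr; apply: iD;
      rewrite inE; exact: dballS rs _ _.
  + move=> d' d'r; have [d ds dd'] := sD _ (dballS rs d'r).
    exists d => //; move: d'r; rewrite -dd' => -[].
    rewrite (hD _ ds).2 (hD _ ds).1 (hD _ (dball_rev ds)).1 -Vr.
    move=> [x xr fx] [y yr fy]; split.
      suff <- : x = origin d by [].
      apply: iV => //; rewrite inE; [exact: gballS rs _ xr|exact: ds.1].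
    suff <- : y = origin (rev d) by [].
    apply: iV => //; rewrite inE; [exact: gballS rs _ yr|exact: ds.2].
- by move=> d dr; exact: hD (dballS rs dr).
- by move=> x xr; exact: lt_le_trans (mV _ (gballS rs xr)) ee'.
- by move=> d dr; exact: lt_le_trans (mD _ (dballS rs dr)) ee'.
Qed.

Lemma network_openT : network_open setT.
Proof. by move=> N _; exists 0%N, 1. Qed.

Lemma network_openI : setI_closed network_open.
Proof.
move=> U V oU oV N [/oU[r [e [e0 hU]]] /oV[s [d [d0 hV]]]].
exists (maxn r s), (Num.min e d); split; first by rewrite lt_min e0.
move=> M h; split; [apply: hU|apply: hV]; apply: locally_closeW h;
  by rewrite ?leq_maxl ?leq_maxr ?ge_min ?lexx ?orbT.
Qed.

Lemma network_open_bigU (I : Type) (F : I -> set (rooted_network Xi k)) :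
  (forall i, network_open (F i)) -> network_open (\bigcup_i F i).
Proof.
move=> oF N [i _ /oF[r [e [e0 h]]]]; exists r, e; split=> // M /h hM.
by exists i.
Qed.

HB.instance Definition _ := @isOpenTopological.Build (rooted_network Xi k)
  network_open network_openT network_openI network_open_bigU.

Let network_isob : rel (rooted_network Xi k) :=
  fun N M => `[< network_iso N M >].

Lemma network_iso_refl : reflexive network_isob.
Proof.
move=> N; apply/asboolP; exists (iso_id _); split.
  by case: (nmark N).
by apply: eq_from_tnth => i; rewrite tnth_map.
Qed.

Lemma network_iso_sym : symmetric network_isob.
Proof.
suff h N M : network_iso N M -> network_iso M N.
  by move=> N M; apply/asboolP/asboolP; exact: h.
move=> [f [fm fr]]; exists (iso_inv f); split.
  rewrite -fm /transport /=; case: (nmark N) => a b /=.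
  by congr pair; apply/funext => x /=; rewrite /vmark /dmark /= ?isoVK ?isoDK.
by rewrite -fr; apply: eq_from_tnth => i; rewrite !tnth_map /= isoVK.
Qed.

Lemma network_iso_trans : transitive network_isob.
Proof.
move=> M N P /asboolP[f [fm fr]] /asboolP[g [gm gr]]; apply/asboolP.
exists (iso_comp g f); split; first by rewrite -gm -fm.
by rewrite -gr -fr; apply: eq_from_tnth => i; rewrite !tnth_map.
Qed.

Canonical network_iso_equiv := EquivRel network_isob
  network_iso_refl network_iso_sym network_iso_trans.

End local_topology.

Local Open Scope quotient_scope.

(* Isomorphism classes of networks with [k] distinguished vertices.  The open
   sets of [rooted_network] are unions of isomorphism classes, so that the
   quotient topology is the local topology on classes. *)
Definition net_space (R : realType) (Xi : completeMetricType R) (k : nat) :=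
  quotient_topology {eq_quot @network_iso_equiv R Xi k}.

HB.instance Definition _ (R : realType) (Xi : completeMetricType R) k :=
  Topological.on (net_space Xi k).
HB.instance Definition _ (R : realType) (Xi : completeMetricType R) k :=
  Quotient.on (net_space Xi k).

Definition net_class (R : realType) (Xi : completeMetricType R) (k : nat)
    (N : rooted_network Xi k) : net_space Xi k := \pi N.

Definition net_repr (R : realType) (Xi : completeMetricType R) (k : nat)
    (c : net_space Xi k) : rooted_network Xi k := repr c.

Definition one_vertex : multigraph :=
  @Multigraph unit Empty_set (fun=> tt) id (fun=> erefl)
    (fun d => match d with end).

Definition trivial_graph : graph.
Proof.
exists one_vertex.
- exact: (inhabits tt).
- by move=> [] []; exists 0%N.
- move=> x; rewrite (_ : [set d | _] = set0); first exact: finite_set0.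
  by apply/seteqP; split=> -[].
Defined.

HB.instance Definition _ (R : realType) (Xi : completeMetricType R) k :=
  isPointed.Build (net_space Xi k)
    (net_class (@RootedNetwork Xi k trivial_graph point [tuple of nseq k tt])).

(* The classes [G, o] and [G, o, x]. *)
Notation Gstar Xi := (net_space Xi 1).
Notation Gstarstar Xi := (net_space Xi 2).

Definition root (Xi : Type) (N : rooted_network Xi 1) : vertex (ngraph N) :=
  thead (nroots N).

Definition birooted (R : realType) (Xi : completeMetricType R)
    (N : rooted_network Xi 1) (x y : vertex (ngraph N)) : Gstarstar Xi :=
  net_class (RootedNetwork (nmark N) [tuple x; y]).

(* The mass-transport principle; [net_repr c] is any network in the class [c],
   on which neither sum depends. *)
Definition unimodular_measure (R : realType) (Xi : completeMetricType R)
    (mu : set (borel (Gstar Xi)) -> \bar R) : Prop :=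
  forall f : borel (Gstarstar Xi) -> \bar R,
    measurable_fun setT f -> (forall z, 0 <= f z)%E ->
    (\int[mu]_c
       (let N := net_repr c in
        \esum_(x in [set: vertex (ngraph N)]) f (birooted (root N) x)) =
     \int[mu]_c
       (let N := net_repr c in
        \esum_(x in [set: vertex (ngraph N)]) f (birooted x (root N))))%E.

Section theorem_data.
Variables (R : realType) (Xi : completeMetricType R) (G : graph).
Variables (haar : {measure set (borel (aut G)) -> \bar R}).
Variable (S : set (vertex G)).
Local Open Scope ereal_scope.

Definition total_weight : \bar R := \esum_(o in S) (haar (stab o))^-1.

Definition rooted_class (w : marking Xi G) (o : vertex G) : Gstar Xi :=
  net_class (RootedNetwork w [tuple o]).

(* The law of [rooted_class w o], for [w] of law [nu] and an independent [o] in
   [S] of law [o |-> total_weight^-1 * (haar (stab o))^-1]. *)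
Definition random_rooting (nu : set (borel (marking Xi G)) -> \bar R)
    (B : set (borel (Gstar Xi))) : \bar R :=
  \esum_(o in S) (total_weight^-1 * (haar (stab o))^-1 *
                  nu [set w | B (rooted_class w o)]).

(* The Haar probability measure of the compact open subgroup [stab z] is the
   normalized restriction of [haar]. *)
Definition stab_haar (z : vertex G) (A : set (aut G)) : \bar R :=
  (haar (stab z))^-1 * haar (A `&` stab z).

Section isomorphisms_to_G.
Variables (G' : multigraph) (x : vertex G').

Definition Phi (z : vertex G) : set (iso G' G) := [set f | isoV f x = z].

(* The measure lambda'_(G', x; z); it does not depend on the choice of [f0]. *)
Definition lambda' (z : vertex G) (B : set (iso G' G)) : \bar R :=
  match pselect (Phi z !=set0) with
  | left nonempty => let f0 := projT1 (cid nonempty) in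
      stab_haar z [set g | B (iso_comp g f0)]
  | right _ => 0
  end.

Definition lambda_ (B : set (iso G' G)) : \bar R :=
  \esum_(z in [set: vertex G]) lambda' z B.

Definition some_vertex : vertex G :=
  projT1 (cid (let: inhabits z := graph_inhabited G in
               ex_intro (fun=> True) z I)).

(* The unique element [o] of [S] with [Phi o] nonempty, when [G'] is isomorphic
   to [G] and [S] is a complete section; [some_vertex] is a dummy value. *)
Definition tau : vertex G :=
  xget some_vertex [set o | S o /\ Phi o !=set0].

End isomorphisms_to_G.

(* The integral over [Phi o (tau o)] of the indicator of [A] is the measure of
   the subset of those [f] for which the transported network lies in [A]. *)
Definition lambda_mu (mu : set (borel (Gstar Xi)) -> \bar R)
    (A : set (borel (marking Xi G))) : \bar R :=
  \int[mu]_c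
    (let N := net_repr c in
     lambda_ (root N) (Phi (root N) (tau (root N)) `&`
                       [set f | A (transport f (nmark N))])).

Definition supported_on (mu : {measure set (borel (Gstar Xi)) -> \bar R}) :
    Prop :=
  {ae mu, forall c, inhabited (iso (ngraph (net_repr c)) G)}.

End theorem_data.

(* Main.v *)
(** Write [m] for the Haar measure, left and right invariant.  For vertices
    [x], [y] in one orbit, [{g | g x = y}] is a coset of [Stab x] and of
    [Stab y], so [sum_(o in S) m(Stab o)^-1 m{g | g x = o} = 1 =
    sum_(o in S) m(Stab o)^-1 m{g | g o = y}].  Inserting these partitions of
    unity on both sides turns [sum_(o in S) m(Stab o)^-1 sum_x phi(o, x)], for
    a diagonally invariant [phi], into a sum over pairs [(o, x)], [(y, o')]
    weighted by [m{g | g o = y, g x = o'}], which is symmetric.  Applied to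
    [phi(x, y) = int f[w, x, y] d nu(w)], this is the mass-transport principle
    for the randomly rooted network.

    Conversely, a network [N] isomorphic to [G] carries the measure [m_N] on
    the isomorphisms [N -> G], the image of [m] under [g |-> g f] for any [f];
    right invariance makes it independent of [f].  Up to the factor
    [m(Stab o)^-1], the inner integral of [lambda_mu] is
    [m_N{f | f root = o, f N in A}].  For all [u], [v] in [G], mass transport
    of [m_N{f | f x = u, f y = v, f N in A}] shows that
    [int m_N{f | f root = u, f N in A} d mu] does not depend on [u], and by
    left invariance replacing [A] by its preimage under [g] only replaces [u]
    by [g u].

    Measurability: both integrands are finite kernels in the test set, so it
    is enough to treat open test sets.  The number of vertices at distance [n]
    for which a birooted network is in an open set is lower semicontinuous.
    So is [m_N{f | f roots = z, f N in A}] on the networks isomorphic to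
    [(G, z)] for open [A], and these networks form a closed set, because
    isomorphisms of larger and larger balls converge, by local finiteness, to
    a global one. *)

Require Import Defs.
From HB Require Import structures.
From mathcomp Require Import all_boot all_order all_algebra.
From mathcomp Require Import all_classical all_reals all_analysis measurable_realfun.

Set Implicit Arguments.
Unset Strict Implicit.
Unset Printing Implicit Defensive.

Import Order.TTheory GRing.Theory Num.Theory.

Local Open Scope classical_set_scope.
Local Open Scope ring_scope.
Local Open Scope ereal_scope.

(* [seq.rev] and [poly.root] shadow the names of Defs. *)
Local Notation rev := Defs.rev.
Local Notation root := Defs.root.

(** * Isomorphisms of balls *)

(** The forward maps determine the inverse ones, and the remaining fields are proofs, equal by proof
    irrelevance. *)
Lemma iso_ext (G H : multigraph) (f g : iso G H) :
  isoV f =1 isoV g -> isoD f =1 isoD g -> f = g.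
Proof.
move=> /funext eV /funext eD.
have eV' : isoV_inv f = isoV_inv g.
  by apply/funext => y; rewrite -{1}(isoV_invK g y) -eV isoVK.
have eD' : isoD_inv f = isoD_inv g.
  by apply/funext => y; rewrite -{1}(isoD_invK g y) -eD isoDK.
case: f g eV eD eV' eD' => a b c d p1 p2 p3 p4 p5 p6 [a' b' c' d' q1 q2 q3 q4 q5 q6] /=.
move=> ? ? ? ?; subst a' b' c' d'.
congr Iso; exact: Prop_irrelevance.
Qed.

Lemma iso_compA (G H K L : multigraph) (h : iso K L) (g : iso H K)
  (f : iso G H) : iso_comp h (iso_comp g f) = iso_comp (iso_comp h g) f.
Proof. exact: iso_ext. Qed.

Lemma iso_invKl (G H : multigraph) (f : iso G H) :
  iso_comp (iso_inv f) f = iso_id G.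
Proof. by apply: iso_ext => x /=; rewrite ?isoVK ?isoDK. Qed.

Lemma iso_invKr (G H : multigraph) (f : iso G H) :
  iso_comp f (iso_inv f) = iso_id H.
Proof. by apply: iso_ext => x /=; rewrite ?isoV_invK ?isoD_invK. Qed.

Lemma iso_comp1 (G H : multigraph) (f : iso G H) : iso_comp f (iso_id G) = f.
Proof. exact: iso_ext. Qed.

Lemma iso_1comp (G H : multigraph) (f : iso G H) : iso_comp (iso_id H) f = f.
Proof. exact: iso_ext. Qed.

Section balls.
Variable G : multigraph.
Implicit Types (C : set (vertex G)) (r s : nat).

(** The darts of the subgraph induced on [C]; for a ball around the roots this is [dball]. *)
Definition idarts C : set (dart G) :=
  [set d | C (origin d) /\ C (origin (rev d))].

Lemma idarts_rev C d : idarts C d -> idarts C (rev d).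
Proof. by move=> [h1 h2]; split => //; rewrite Defs.revK. Qed.

Lemma idartsS C C' : C `<=` C' -> idarts C `<=` idarts C'.
Proof. by move=> CC' d [? ?]; split; exact: CC'. Qed.

Lemma gball_subset C C' r : C `<=` C' -> gball C r `<=` gball C' r.
Proof.
move=> CC'; elim: r => //= r IH x [/IH xr|[d /= /IH dr <-]]; first by left.
by right; exists d.
Qed.

Lemma gball_sub C r : C `<=` gball C r.
Proof. exact: (@gballS G C 0). Qed.

Lemma gballD C r s : gball (gball C r) s = gball C (r + s).
Proof. by elim: s => [|s IH]; rewrite ?addn0// addnS /= IH. Qed.

Lemma gball_finite C r : locally_finite G -> finite_set C ->
  finite_set (gball C r).
Proof.
move=> lf fC; elim: r => //= r IH; rewrite finite_setU; split => //.
apply: finite_image.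
have -> : [set d : dart G | gball C r (origin d)] =
    \bigcup_(x in gball C r) [set d | origin d = x].
  by apply/seteqP; split => [d dr|d [x xr /= ->]] //; exists (origin d).
by apply: bigcup_finite => // x _; exact: lf.
Qed.

Lemma idarts_finite C : locally_finite G -> finite_set C ->
  finite_set (idarts C).
Proof.
move=> lf fC; apply: (@sub_finite_set _ _
    (\bigcup_(x in C) [set d | origin d = x])).
  by move=> d [dC _]; exists (origin d).
by apply: bigcup_finite => // x _; exact: lf.
Qed.

End balls.

Section partial_iso.
Context {G H : multigraph}.
Implicit Types (A B C : set (vertex G)) (U : set (vertex H)).
Implicit Types (fV : vertex G -> vertex H) (fD : dart G -> dart H).

(** An isomorphism of induced subgraphs, given by total functions whose values off [B] and
    [idarts B] are arbitrary. *)
Definition partial_iso B U fV fD : Prop :=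
  [/\ set_bij B U fV, set_bij (idarts B) (idarts U) fD &
      forall d, idarts B d ->
        origin (fD d) = fV (origin d) /\ rev (fD d) = fD (rev d)].

(** A dart joining images of points of [A] has a preimage in [idarts B], whose ends lie in [A] by
    injectivity of [fV] on [B]. *)
Lemma partial_iso_sub B U A fV fD : A `<=` B -> partial_iso B U fV fD ->
  partial_iso A (fV @` A) fV fD.
Proof.
move=> AB [[fV1 iV sV] [fD1 iD sD] hD].
split; [split|split|] => //.
- by move=> x y; rewrite !inE => xr yr; apply: iV; rewrite inE; exact: AB.
- move=> d dr; have ds := idartsS AB dr; split.
    by rewrite (hD _ ds).1; exists (origin d) => //; exact: dr.1.
  rewrite (hD _ ds).2 (hD _ (idarts_rev ds)).1.
  by exists (origin (rev d)) => //; exact: dr.2.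
- by move=> x y; rewrite !inE => xr yr; apply: iD; rewrite inE; exact: idartsS AB _ _.
- move=> d' [[x xA fx] [y yA fy]].
  have [|d ds dd'] := sD d'.
    by split; [rewrite -fx; apply: fV1; exact: AB|rewrite -fy; apply: fV1; exact: AB].
  exists d => //; move: fx fy; rewrite -dd'.
  rewrite (hD _ ds).2 (hD _ ds).1 (hD _ (idarts_rev ds)).1 => fx fy; split.
    suff <- : x = origin d by [].
    by apply: iV => //; rewrite inE; [exact: AB|exact: ds.1].
  suff <- : y = origin (rev d) by [].
  by apply: iV => //; rewrite inE; [exact: AB|exact: ds.2].
- by move=> d dr; exact: hD (idartsS AB dr).
Qed.

(** Induction on [s]: a dart starting at distance less than [s] from [C] or from its image lies in
    [idarts B] or [idarts U], where [fD] matches the two sides, so both balls grow together. *)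
Lemma partial_iso_gball B U C s fV fD : partial_iso B U fV fD ->
  gball C s `<=` B -> gball (fV @` C) s `<=` U ->
  fV @` gball C s = gball (fV @` C) s.
Proof.
move=> [[fV1 iV sV] [fD1 iD sD] hD].
elim: s => //= t IH sB sU.
have {}IH : [set fV x | x in gball C t] = gball [set fV x | x in C] t.
  by apply: IH => x xt; [apply: sB; left|apply: sU; left].
have dP d : gball C t (origin d) -> idarts B d.
  by move=> dt; split; apply: sB; [left|right; exists d].
apply/seteqP; split.
  move=> _ [x + <-] => -[xt|[d /= dt <-]].
    by left; rewrite -IH; exists x.
  have ds := dP _ dt.
  right; exists (fD d) => /=.
    by rewrite (hD _ ds).1 -IH; exists (origin d).
  by rewrite (hD _ ds).2 (hD _ (idarts_rev ds)).1.
move=> y [|[d' /= d't <-]].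
  by rewrite -IH => -[x xt <-]; exists x => //; left.
have [|d ds dd'] := sD d'.
  by split; apply: sU; [left|right; exists d'].
move: d't; rewrite -IH -dd' (hD _ ds).1 => -[x xt fx].
have {}fx : x = origin d.
  by apply: iV => //; rewrite inE; [apply: sB; left|exact: ds.1].
exists (origin (rev d)).
  by right; exists d => //=; rewrite -fx.
by rewrite -(hD _ (idarts_rev ds)).1 -(hD _ ds).2.
Qed.

Lemma iso_partial_iso (f : iso G H) :
  partial_iso setT setT (isoV f) (isoD f).
Proof.
split; [split|split|] => //.
- by move=> x y _ _ /(congr1 (isoV_inv f)); rewrite !isoVK.
- by move=> y _; exists (isoV_inv f y); rewrite ?isoV_invK.
- by move=> x y _ _ /(congr1 (isoD_inv f)); rewrite !isoDK.
- by move=> y _; exists (isoD_inv f y); rewrite ?isoD_invK.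
- by move=> d _; rewrite iso_origin iso_rev.
Qed.

Lemma iso_gball (f : iso G H) C r :
  isoV f @` gball C r = gball (isoV f @` C) r.
Proof. exact: partial_iso_gball (iso_partial_iso f) _ _. Qed.

End partial_iso.

Lemma partial_iso_comp (G H K : multigraph) (A : set (vertex G))
    (B : set (vertex H)) (C : set (vertex K)) fV fD gV gD :
  partial_iso A B fV fD -> partial_iso B C gV gD ->
  partial_iso A C (gV \o fV) (gD \o fD).
Proof.
move=> [bV bD hf] [bV' bD' hg]; split.
- exact: set_bij_comp bV bV'.
- exact: set_bij_comp bD bD'.
- move=> d dA /=; have fdB : idarts B (fD d) by case: bD => + _ _; apply.
  by rewrite (hg _ fdB).1 (hg _ fdB).2 (hf _ dA).1 (hf _ dA).2.
Qed.

Section ball_iso.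
Context {k : nat}.

Definition tball (G : multigraph) (x : k.-tuple (vertex G)) (r : nat) :
  set (vertex G) := gball (range (tnth x)) r.

Lemma range_tnth_map (T U : Type) (f : T -> U) (x : k.-tuple T) :
  range (tnth (map_tuple f x)) = f @` range (tnth x).
Proof.
apply/seteqP; split.
  by move=> _ [i _ <-]; rewrite tnth_map; exists (tnth x i) => //; exists i.
by move=> _ [_ [i _ <-] <-]; exists i => //; rewrite tnth_map.
Qed.

Lemma tball_finite (G : graph) (x : k.-tuple (vertex G)) r :
  finite_set (tball x r).
Proof.
apply: gball_finite; first exact: graph_locally_finite.
by apply: finite_image; exact: finite_finset.
Qed.

Definition ball_iso (G H : multigraph) (x : k.-tuple (vertex G))
    (y : k.-tuple (vertex H)) r fV fD : Prop :=
  partial_iso (tball x r) (tball y r) fV fD /\ map_tuple fV x = y.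

(** Since [r + s <= R], the [s]-neighbourhoods of [C] and of its image stay inside the balls of
    radius [R], which the partial isomorphism matches. *)
Lemma ball_iso_gball (G H : multigraph) (x : k.-tuple (vertex G))
    (y : k.-tuple (vertex H)) r s R fV fD (C : set (vertex G)) :
  ball_iso x y R fV fD -> C `<=` tball x r -> (r + s <= R)%N ->
  fV @` gball C s = gball (fV @` C) s.
Proof.
move=> [pf xy] Cr rsR.
have rR : (r <= R)%N by apply: leq_trans rsR; exact: leq_addr.
have fr : fV @` tball x r = tball y r.
  rewrite /tball -xy range_tnth_map; apply: (partial_iso_gball pf).
    exact: gballS.
  by rewrite -range_tnth_map xy; exact: gballS.
apply: (partial_iso_gball pf).
  apply: subset_trans (gball_subset Cr) _; rewrite gballD; exact: gballS.
have : fV @` C `<=` tball y r by rewrite -fr; exact: image_subset.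
move=> /(@gball_subset _ _ _ s) h; apply: subset_trans h _; rewrite gballD; exact: gballS.
Qed.

Lemma ball_iso_tball (G H : multigraph) (x : k.-tuple (vertex G))
    (y : k.-tuple (vertex H)) r R fV fD :
  ball_iso x y R fV fD -> (r <= R)%N -> fV @` tball x r = tball y r.
Proof.
move=> fi rR; rewrite (ball_iso_gball (r := 0) fi)//.
by case: fi => _ <-; rewrite /tball range_tnth_map.
Qed.

Lemma ball_isoW (G H : multigraph) (x : k.-tuple (vertex G))
    (y : k.-tuple (vertex H)) r R fV fD : (r <= R)%N ->
  ball_iso x y R fV fD -> ball_iso x y r fV fD.
Proof.
move=> rR fi; split; last by case: fi.
rewrite -(ball_iso_tball fi rR); apply: partial_iso_sub fi.1; exact: gballS.
Qed.

Lemma iso_ball_iso (G H : multigraph) (f : iso G H) (x : k.-tuple (vertex G)) r :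
  ball_iso x (map_tuple (isoV f) x) r (isoV f) (isoD f).
Proof.
split=> //; rewrite /tball range_tnth_map -iso_gball.
exact: partial_iso_sub (iso_partial_iso f).
Qed.

Lemma ball_iso_comp (G H K : multigraph) (x : k.-tuple (vertex G))
    (y : k.-tuple (vertex H)) (z : k.-tuple (vertex K)) r fV fD gV gD :
  ball_iso x y r fV fD -> ball_iso y z r gV gD ->
  ball_iso x z r (gV \o fV) (gD \o fD).
Proof.
move=> [pf xy] [pg yz]; split; first exact: partial_iso_comp pf pg.
rewrite -yz -xy; by apply: eq_from_tnth => i; rewrite !tnth_map.
Qed.

End ball_iso.

(** * Limits of ball isomorphisms *)

Section ultrafilter_limit.

Lemma filter_forall_finite (T : Type) (I : eqType) (F : set_system T)
    (FF : Filter F) (D : set I) (P : I -> set T) :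
  finite_set D -> (forall i, D i -> F (P i)) ->
  F [set t | forall i, D i -> P i t].
Proof.
move=> /finite_seqP[s ->]; elim: s => [|i s IH] h.
  by apply: (@filterS _ F _ setT); [move=> t _ i; rewrite /= in_nil|exact: filterT].
apply: (@filterS _ F _ (P i `&` [set t | forall i, [set` s] i -> P i t])).
  by move=> t [it st] j /=; rewrite inE => /predU1P[->//|]; exact: st.
apply: filterI; first by apply: h; rewrite /= inE eqxx.
by apply: IH => j /= js; apply: h; rewrite /= inE js orbT.
Qed.

(** Otherwise the complements of the finitely many [P i] all belong to [F], and their intersection
    misses the set of the hypothesis. *)
Lemma ultra_exists_finite (T : Type) (I : eqType) (F : set_system T)
    (UF : UltraFilter F) (D : set I) (P : I -> set T) :
  finite_set D -> F [set t | exists2 i, D i & P i t] ->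
  exists2 i, D i & F (P i).
Proof.
move=> fD FD; apply: contrapT => noi.
have FC : F [set t | forall i, D i -> (~` P i) t].
  apply: filter_forall_finite => // i Di.
  by have [Pi|//] := in_ultra_setVsetC (P i) UF; case: noi; exists i.
by have [t [[i Di Pit] h]] := filter_ex (filterI FD FC); exact: (h i).
Qed.

Variables (T : Type) (F : set_system T) (UF : UltraFilter F).
Variables (G H : graph) (k : nat).
Variables (x : k.+1.-tuple (vertex G)) (y : k.+1.-tuple (vertex H)).
Variables (aV : T -> vertex G -> vertex H) (aD : T -> dart G -> dart H).
Hypothesis a_ball_iso : forall r, F [set t | ball_iso x y r (aV t) (aD t)].

Lemma tball_cover (K : graph) (z : k.+1.-tuple (vertex K)) v :
  exists r, tball z r v.
Proof.
have [r vr] := @graph_connected K (tnth z ord0) v.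
by exists r; apply: gball_subset vr => _ ->; exists ord0.
Qed.

Lemma idarts_tball_cover (K : graph) (z : k.+1.-tuple (vertex K)) d :
  exists r, idarts (tball z r) d.
Proof.
have [r vr] := tball_cover z (origin d); exists r.+1; split; first by left.
by right; exists d.
Qed.

Let limV v : {v' | F [set t | aV t v = v']}.
Proof.
apply: cid; have [r vr] := tball_cover x v.
have [||v' _] := @ultra_exists_finite T _ F UF (tball y r)
  (fun v' => [set t | aV t v = v']); last by exists v'.
- exact: tball_finite.
- apply: filterS (a_ball_iso r) => t [[[fV _ _] _ _] _].
  by exists (aV t v) => //; exact: fV.
Qed.

Let limD d : {d' | F [set t | aD t d = d']}.
Proof.
apply: cid; have [r dr] := idarts_tball_cover x d.
have [||d' _] := @ultra_exists_finite T _ F UF (idarts (tball y r))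
  (fun d' => [set t | aD t d = d']); last by exists d'.
- apply: idarts_finite (tball_finite _ _); exact: graph_locally_finite.
- apply: filterS (a_ball_iso r) => t [[_ [fD _ _] _] _].
  by exists (aD t d) => //; exact: fD.
Qed.

Let fV v := sval (limV v).
Let fVP v : F [set t | aV t v = fV v] := svalP (limV v).
Let fD d := sval (limD d).
Let fDP d : F [set t | aD t d = fD d] := svalP (limD d).

Let fV_bij : bijective fV.
Proof.
rewrite -setTT_bijective; split => // [v v' _ _ vv'|v' _].
  have [r vr] := tball_cover x v; have [r' vr'] := tball_cover x v'.
  have [t [[/= ev ev'] [[[_ iV _] _ _] _]]] := filter_ex
    (filterI (filterI (fVP v) (fVP v')) (a_ball_iso (maxn r r'))).
  apply: iV; rewrite ?inE; last by rewrite ev ev'.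
    exact: gballS (leq_maxl _ _) _ vr.
  exact: gballS (leq_maxr _ _) _ vr'.
(* Surjectivity: the preimages of [v'] under the [aV t] can be sought in one finite ball, so the
   ultrafilter selects one of them. *)
have [r vr] := tball_cover y v'.
have [||v _ Fv] := @ultra_exists_finite T _ F UF (tball x r)
  (fun v => [set t | aV t v = v']).
- exact: tball_finite.
- apply: filterS (a_ball_iso r) => t [[[_ _ sV] _ _] _].
  by have [v vr' <-] := sV _ vr; exists v.
exists v => //.
by have [t [/= <- <-]] := filter_ex (filterI (fVP v) Fv).
Qed.

Let fD_bij : bijective fD.
Proof.
rewrite -setTT_bijective; split => // [d d' _ _ dd'|d' _].
  have [r dr] := idarts_tball_cover x d; have [r' dr'] := idarts_tball_cover x d'.
  have [t [[/= ed ed'] [[_ [_ iD _] _] _]]] := filter_ex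
    (filterI (filterI (fDP d) (fDP d')) (a_ball_iso (maxn r r'))).
  apply: iD; rewrite ?inE; last by rewrite ed ed'.
    by apply: idartsS dr; exact: gballS (leq_maxl _ _).
  by apply: idartsS dr'; exact: gballS (leq_maxr _ _).
have [r dr] := idarts_tball_cover y d'.
have [||d _ Fd] := @ultra_exists_finite T _ F UF (idarts (tball x r))
  (fun d => [set t | aD t d = d']).
- apply: idarts_finite (tball_finite _ _); exact: graph_locally_finite.
- apply: filterS (a_ball_iso r) => t [[_ [_ _ sD] _] _].
  by have [d dr' <-] := sD _ dr; exists d.
exists d => //.
by have [t [/= <- <-]] := filter_ex (filterI (fDP d) Fd).
Qed.

Let fVD d : origin (fD d) = fV (origin d) /\ rev (fD d) = fD (rev d).
Proof.
have [r dr] := idarts_tball_cover x d.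
have [t [[[/= ed ed'] ev] [[_ _ ht] _]]] := filter_ex
  (filterI (filterI (filterI (fDP d) (fDP (rev d))) (fVP (origin d)))
     (a_ball_iso r)).
by have [+ +] := ht _ dr; rewrite ed ed' ev.
Qed.

(* The ultrafilter picks one of the finitely many images of each vertex and
   dart; the choices are coherent because members of [F] intersect. *)
Lemma ultra_iso : exists f : iso G H, [/\ map_tuple (isoV f) x = y,
  forall v, F [set t | aV t v = isoV f v] &
  forall d, F [set t | aD t d = isoD f d]].
Proof.
have [gV fVK gVK] := fV_bij; have [gD fDK gDK] := fD_bij.
exists (@Iso G H fV fD gV gD fVK gVK fDK gDK
  (fun d => (fVD d).1) (fun d => (fVD d).2)); split => //=.
apply: eq_from_tnth => i; rewrite tnth_map.
have [t [/= <- [_ <-]]] := filter_ex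
  (filterI (fVP (tnth x i)) (a_ball_iso 0)).
by rewrite tnth_map.
Qed.

End ultrafilter_limit.

(** * Countable sums and kernels *)

Lemma borel_open (T : ptopologicalType) (U : set T) :
  open U -> measurable (U : set (borel T)).
Proof. exact: sub_sigma_algebra. Qed.

Lemma borel_measurable_fun d (X : measurableType d) (T : ptopologicalType)
    (f : X -> borel T) :
  (forall U : set T, open U -> measurable (f @^-1` U)) ->
  measurable_fun setT f.
Proof.
move=> h; apply: (@measurability _ _ X (borel T) setT f (@open T)) => //.
by move=> _ [U oU <-]; rewrite setTI; exact: h.
Qed.

Lemma continuous_borel (T U : ptopologicalType) (f : T -> U) : continuous f ->
  measurable_fun setT (f : borel T -> borel U).
Proof.
move=> /continuousP cf; apply: borel_measurable_fun => A oA.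
by apply: borel_open; exact: cf.
Qed.

Lemma le_esum_subset (R : realType) (I : choiceType) (A B : set I) (a : I -> \bar R) :
  A `<=` B -> (forall i, 0 <= a i) -> \esum_(i in A) a i <= \esum_(i in B) a i.
Proof.
move=> AB a0; rewrite (esum_mkcond A) (esum_mkcond B); apply: le_esum => i _.
case: ifPn => [/set_mem/AB/mem_set ->//|_]; by case: ifPn.
Qed.

Lemma esum_single (R : realType) (I : choiceType) (D : set I) (a : I -> \bar R) i :
  D i -> (forall j, D j -> 0 <= a j) -> (forall j, D j -> j <> i -> a j = 0) ->
  \esum_(j in D) a j = a i.
Proof.
move=> Di a0 ai; rewrite (esumID [set i])// (setIidr (B := [set i])).
  rewrite [X in _ + X]esum1 => [|j [Dj /= ji]]; last exact: ai.
  by rewrite adde0 esum_set1// a0.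
by move=> _ ->.
Qed.

Lemma exchange_esum (R : realType) (I J : choiceType) (A : set I) (B : set J)
    (a : I -> J -> \bar R) : (forall i j, 0 <= a i j) ->
  \esum_(i in A) \esum_(j in B) a i j = \esum_(j in B) \esum_(i in A) a i j.
Proof.
move=> a0; rewrite !esum_esum//.
rewrite (@reindex_esum _ _ _ (B `*`` fun=> A) _ (fun k => (k.2, k.1)))//.
split; first by move=> [j i] [].
  by move=> [j i] [j' i'] _ _ [-> ->].
by move=> [i j] [Ai Bj]; exists (j, i).
Qed.

Section countable_sums.
Context {R : realType} {I : choiceType} (D : set I) (cD : countable D).
Implicit Types a : I -> \bar R.

(** Pieces with at most one element, indexed by [nat], turn sums over [D] into series, to which
    monotone convergence and countable additivity apply. *)
Lemma countable_enum : exists e : nat -> set I,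
  [/\ trivIset setT e, \bigcup_n e n = D &
      forall n, e n = set0 \/ exists i, e n = [set i]].
Proof.
have /countable_injP[f fi] := cD.
exists (fun n => D `&` f @^-1` [set n]); split.
- by move=> n n' _ _ [i [[_ /= <-] [_ /= <-]]].
- apply/seteqP; split => [i [n _ []]//|i Di]; by exists (f i).
- move=> n; have [->|/set0P[i [Di fin]]] := eqVneq (D `&` f @^-1` [set n]) set0.
    by left.
  right; exists i; apply/seteqP; split => [j [Dj fjn]|_ ->//].
  by apply: fi; rewrite ?inE// fjn fin.
Qed.

Let e := sval (cid countable_enum).
Let et : trivIset setT e. Proof. by case: (svalP (cid countable_enum)). Qed.
Let eD : \bigcup_n e n = D. Proof. by case: (svalP (cid countable_enum)). Qed.
Let e01 n : e n = set0 \/ exists i, e n = [set i].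
Proof. by case: (svalP (cid countable_enum)). Qed.

Let esum_e a : (forall i, 0 <= a i) ->
  \esum_(i in D) a i = \sum_(n <oo) \esum_(i in e n) a i.
Proof. by move=> a0; rewrite -nneseries_sum_bigcup// eD. Qed.

Lemma esumZl a (b : \bar R) : 0 <= b -> (forall i, 0 <= a i) ->
  \esum_(i in D) (b * a i) = b * \esum_(i in D) a i.
Proof.
move=> b0 a0; have ba0 i : 0 <= b * a i by exact: mule_ge0.
case: b b0 ba0 => [r r0 ra0|_ ya0|]; last by [].
  rewrite !esum_e// -nneseriesZl => [|n _]; last exact: esum_ge0.
  apply: eq_eseriesr => n _; have [->|[i ->]] := e01 n.
    by rewrite !esum_set0 mule0.
  by rewrite !esum_set1.
(* Case [b = +oo]: both sides vanish if [a] does on [D]; otherwise a single positive [a i] makes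
   both infinite. *)
have [az|/existsNP[i /not_implyP[Di ai]]] :=
    pselect (forall i, D i -> a i = 0).
  by rewrite !esum1 ?mule0// => i Di; rewrite az ?mule0.
have ai0 : 0 < a i by rewrite lt0e a0 andbT; exact/eqP.
have le (b : I -> \bar R) : (forall i, 0 <= b i) -> b i <= \esum_(j in D) b j.
  move=> b0; rewrite -[leLHS](@esum_set1 R _ i b)//.
  by apply: le_esum_subset => // _ ->.
rewrite [RHS]gt0_mulye; last exact: lt_le_trans ai0 (le _ a0).
by apply/eqP; rewrite -leye_eq -[leLHS](gt0_mulye ai0); exact: (le _ ya0).
Qed.

Lemma integral_esum d (T : measurableType d) (mu : {measure set T -> \bar R})
    (f : I -> T -> \bar R) :
  (forall i, measurable_fun setT (f i)) -> (forall i x, 0 <= f i x) ->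
  \int[mu]_x (\esum_(i in D) f i x) = \esum_(i in D) \int[mu]_x f i x.
Proof.
move=> mf f0; under eq_integral do rewrite esum_e//.
rewrite integral_nneseries//; last by move=> n x _; exact: esum_ge0.
  rewrite esum_e//; last by move=> i; exact: integral_ge0.
  apply: eq_eseriesr => n _; have [->|[i ->]] := e01 n.
    under eq_integral do rewrite esum_set0.
    by rewrite integral0 esum_set0.
  under eq_integral do rewrite esum_set1//.
  by rewrite esum_set1//; exact: integral_ge0.
move=> n; have [->|[i ->]] := e01 n.
  under eq_fun do rewrite esum_set0; exact: measurable_cst.
under eq_fun do rewrite esum_set1//; exact: mf.
Qed.

Lemma esum_measure d (T : measurableType d) (m : I -> {measure set T -> \bar R}) :
  exists mu : {measure set T -> \bar R},
    (forall A, mu A = \esum_(i in D) m i A) /\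
    (forall f, measurable_fun setT f -> (forall x, 0 <= f x) ->
       (\int[mu]_x f x) = \esum_(i in D) \int[m i]_x f x).
Proof.
(* The piece [e n] is empty or a singleton; an empty piece contributes the zero measure to the
   series. *)
pose m' n : {measure set T -> \bar R} :=
  if pselect (exists i, e n = [set i]) is left ex then m (sval (cid ex))
  else mzero.
have m'E n (F : {measure set T -> \bar R} -> \bar R) : F mzero = 0 ->
    (forall mu, 0 <= F mu) -> F (m' n) = \esum_(i in e n) F (m i).
  move=> Fz F0; rewrite /m'; case: pselect => [ex|nex].
    by case: (cid ex) => i /= ->; rewrite esum_set1.
  by have [->|//] := e01 n; rewrite esum_set0.
exists (mseries m' 0); split => [A|f mf f0].
  rewrite /mseries esum_e//; apply: eq_eseriesr => n _.
  exact: (m'E n (fun mu => mu A)).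
rewrite ge0_integral_measure_series// esum_e; last first.
  by move=> i; exact: integral_ge0.
apply: eq_eseriesr => n _.
apply: (m'E n (fun mu => \int[mu]_x f x)); first by rewrite integral_measure_zero.
by move=> mu; exact: integral_ge0.
Qed.

Lemma measure_esum_bigcup d (T : measurableType d)
    (mu : {measure set T -> \bar R}) (F : I -> set T) :
  (forall i, measurable (F i)) -> trivIset D F ->
  mu (\bigcup_(i in D) F i) = \esum_(i in D) mu (F i).
Proof.
move=> mF tF; rewrite esum_e//.
have -> : \bigcup_(i in D) F i = \bigcup_n \bigcup_(i in e n) F i.
  by rewrite -eD bigcup_bigcup.
rewrite measure_bigcup//.
- rewrite [LHS]eseries_mkcond; apply: eq_eseriesr => n _; rewrite in_setT.
  have [->|[i ->]] := e01 n.
    by rewrite bigcup_set0 measure0 esum_set0.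
  by rewrite bigcup_set1 esum_set1.
- move=> n _; have [->|[i ->]] := e01 n; first by rewrite bigcup_set0.
  by rewrite bigcup_set1.
- move=> n n' _ _ [t [[i ein Fit] [j ejn Fjt]]].
  have ij : i = j.
    by apply: tF; [rewrite -eD; exists n|rewrite -eD; exists n'|exists t].
  by apply: et => //; exists i; split => //; rewrite ij.
Qed.

End countable_sums.

(** Bundles the scaled image measure with its change of variables formula; finiteness of [a]
    provides the nonnegative real that [mscale] takes. *)
Lemma scaled_pushforward (R : realType) d d' (X : measurableType d)
    (Y : measurableType d') (nu : {measure set X -> \bar R}) (f : X -> Y)
    (mf : measurable_fun setT f) (a : \bar R) : 0 <= a -> a < +oo ->
  exists mu : {measure set Y -> \bar R},
    (forall A, mu A = a * nu (f @^-1` A)) /\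
    (forall g, measurable_fun setT g -> (forall y, 0 <= g y) ->
       (\int[mu]_y g y) = a * \int[nu]_x g (f x)).
Proof.
case: a => // r; rewrite lee_fin => r0 _.
pose p : {measure set Y -> \bar R} := pushforward nu f.
exists (mscale (NngNum r0) (p mf)); split => // g mg g0.
rewrite ge0_integral_mscale//; congr (_ * _).
by rewrite ge0_integral_pushforward.
Qed.

(** The open sets are stable under intersection and generate the Borel sets, and the good sets [A]
    form a Dynkin class; finiteness of the kernel handles complements. *)
Lemma borel_kernel_measurable (R : realType) d (X : measurableType d)
    (T : ptopologicalType) (k : X -> {measure set (borel T) -> \bar R}) :
  (forall x, k x setT < +oo) ->
  (forall U : set T, open U -> measurable_fun setT (fun x => k x U)) ->
  forall A : set (borel T), measurable A -> measurable_fun setT (fun x => k x A).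
Proof.
move=> kfin kU.
have kT : measurable_fun setT (fun x => k x setT) by apply: kU; exact: openT.
apply: (@dynkin_induction _ (borel T) (@open T)) => //.
- by move=> A B; exact: openI.
- move=> A mA kA.
  rewrite (_ : (fun _ => _) = fun x => k x setT - k x A).
    exact: emeasurable_funB.
  apply/funext => x; have kx := kfin x.
  by rewrite -setTD measureD ?setTI.
- move=> F mF tF kF.
  rewrite (_ : (fun _ => _) = fun x => \sum_(n <oo) k x (F n)).
    by apply: ge0_emeasurable_sum.
  by apply/funext => x; rewrite measure_semi_bigcup//; exact: bigcupT_measurable.
Qed.

(** * Automorphism groups and Haar measure *)

Section aut_topology.
Variable G : graph.
Implicit Types (f g h : aut G) (x y : vertex G) (U : set (aut G)).

Lemma nbhs_aut g U : nbhs g U <-> exists A B, [/\ finite_set A, finite_set B &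
  forall h, (forall x, A x -> isoV h x = isoV g x) ->
    (forall d, B d -> isoD h d = isoD g d) -> U h].
Proof.
rewrite nbhsE /=; split.
  move=> [V [oV Vg] VU]; have [A [B [fA fB h]]] := oV _ Vg.
  exists A, B; split => // k hA hB; apply/VU/h.
    by move=> x; rewrite inE; exact: hA.
  by move=> x; rewrite inE; exact: hB.
move=> [A [B [fA fB hU]]].
exists [set h | {in A, isoV h =1 isoV g} /\ {in B, isoD h =1 isoD g}].
  split; last by split.
  move=> h [hA hB]; exists A, B; split => // h' h'A h'B; split.
    by move=> x xA; rewrite h'A// hA.
  by move=> x xB; rewrite h'B// hB.
by move=> h [hA hB]; apply: hU => x xA; [apply: hA|apply: hB]; rewrite inE.
Qed.

Lemma open_autP U : open U <-> forall g, U g ->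
  exists A B, [/\ finite_set A, finite_set B &
  forall h, (forall x, A x -> isoV h x = isoV g x) ->
    (forall d, B d -> isoD h d = isoD g d) -> U h].
Proof.
rewrite openE; split => h g /h; first by move=> /nbhs_aut.
by move=> /nbhs_aut.
Qed.

Lemma open_isoV x y : open [set g : aut G | isoV g x = y].
Proof.
apply/open_autP => g /= <-; exists [set x], set0; split => //.
by move=> h /(_ x erefl).
Qed.

(** An ultrafilter on the stabilizer consists of automorphisms that restrict to isomorphisms of all
    balls around [x], so [ultra_iso] provides a limit, and pointwise convergence on finite sets is
    convergence in [aut G]. *)
Lemma compact_stab x : compact (@stab G x).
Proof.
rewrite compact_ultra => F UF Fx.
have [|f [fx fV fD]] := @ultra_iso _ F UF G G 0 [tuple x] [tuple x]
    (fun g => isoV g) (fun g => isoD g).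
  move=> r; apply: filterS Fx => g gx.
  have := iso_ball_iso g [tuple x] r; congr (ball_iso _ _ _ _ _).
  by apply: eq_from_tnth => i; rewrite tnth_map !ord1 /= gx.
exists f; split.
  have := congr1 (fun t => tnth t ord0) fx; by rewrite tnth_map.
move=> U /= /nbhs_aut[A [B [fA fB hU]]].
apply: (@filterS _ F _ ([set h | forall x, A x -> isoV h x = isoV f x] `&`
   [set h | forall d, B d -> isoD h d = isoD f d])).
  by move=> h [hA hB]; exact: hU.
apply: filterI; apply: filter_forall_finite => // i _; [exact: fV|exact: fD].
Qed.

Lemma countable_vertex : countable [set: vertex G].
Proof.
have [x] := graph_inhabited G.
have -> : [set: vertex G] = \bigcup_r tball [tuple x] r.
  apply/seteqP; split => // y _; have [r yr] := tball_cover [tuple x] y.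
  by exists r.
apply: bigcup_countable => // r _; exact/finite_set_countable/tball_finite.
Qed.

End aut_topology.

Section haar_measure.
Context {R : realType} {G : graph}.
Variable haar : {measure set (borel (aut G)) -> \bar R}.
Hypothesis haarP : is_haar haar.
Implicit Types (x y : vertex G) (g : aut G) (A : set (borel (aut G))).

Lemma measurable_isoV x y :
  measurable ([set g | isoV g x = y] : set (borel (aut G))).
Proof. by apply: borel_open; exact: open_isoV. Qed.

Lemma haar_compl g A : measurable A ->
  haar [set h | A (iso_comp g h)] = haar A.
Proof.
case: haarP => _ _ hl mA; rewrite -(hl (iso_inv g) A mA); congr (haar _).
apply/seteqP; split => [h Ah|_ [h Ah <-]] /=.
  by exists (iso_comp g h) => //; rewrite iso_compA iso_invKl iso_1comp.
by rewrite iso_compA iso_invKr iso_1comp.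
Qed.

Lemma haar_compr (rinv : right_invariant haar) g A : measurable A ->
  haar [set h | A (iso_comp h g)] = haar A.
Proof.
move=> mA; rewrite -(rinv (iso_inv g) A mA); congr (haar _).
apply/seteqP; split => [h Ah|_ [h Ah <-]] /=.
  by exists (iso_comp h g) => //; rewrite -iso_compA iso_invKr iso_comp1.
by rewrite -iso_compA iso_invKl iso_comp1.
Qed.

Lemma haar_stab_lty x : haar (@stab G x) < +oo.
Proof. by case: haarP => _ h _; exact/h/compact_stab. Qed.

(** The set is the left coset of the stabilizer of [x] by [g]. *)
Lemma haar_isoV_left g x : haar [set h | isoV h x = isoV g x] = haar (@stab G x).
Proof.
rewrite -(@haar_compl g); last exact: measurable_isoV.
congr (haar _); apply/seteqP; split => h; rewrite /stab /=; last by move=> ->.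
by move=> /(congr1 (isoV_inv g)); rewrite !isoVK.
Qed.

(** The same set is also a right coset of the stabilizer of [g x]; this is where unimodularity of
    the group enters. *)
Lemma haar_isoV_right (rinv : right_invariant haar) g x :
  haar [set h | isoV h x = isoV g x] = haar (@stab G (isoV g x)).
Proof.
rewrite -(@haar_compr rinv (iso_inv g) (@stab G (isoV g x))); last first.
  exact: measurable_isoV.
by congr (haar _); apply/seteqP; split => h; rewrite /stab /= isoVK.
Qed.

(** The group is a countable union of left cosets of the stabilizer, one for each vertex in the
    orbit of [x]; if these were null, so would be the group. *)
Lemma haar_stab_gt0 x : 0 < haar (@stab G x).
Proof.
rewrite lt0e measure_ge0 andbT; apply/negP => /eqP hx0.
case: haarP => /eqP + _ _; apply.
rewrite -[LHS]/(haar setT) (_ : setT = \bigcup_(y in [set: vertex G])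
    [set h | isoV h x = y]); last first.
  by apply/seteqP; split => // h _; exists (isoV h x).
rewrite measure_esum_bigcup.
- apply: esum1 => y _.
  have [[g gxy]|ng] := pselect (exists g : aut G, isoV g x = y).
    by rewrite -gxy haar_isoV_left.
  rewrite (_ : [set h | _] = set0) ?measure0//.
  by apply/seteqP; split => // h hxy; case: ng; exists h.
- exact: countable_vertex.
- by move=> y; exact: measurable_isoV.
- by move=> y y' _ _ [h [/= <- <-]].
Qed.

Lemma haar_stab_fin_num x : haar (@stab G x) \is a fin_num.
Proof. by rewrite ge0_fin_numE ?measure_ge0//; exact: haar_stab_lty. Qed.

End haar_measure.

(** * Topology of markings *)

Section marking_topology.
Context {R : realType} {Xi : completeMetricType R}.

Lemma nbhs_ptws (I : choiceType) (f : {ptws I -> Xi}) (U : set {ptws I -> Xi}) :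
  nbhs f U <-> exists A e, [/\ finite_set A, (0 < e)%R &
    forall f' : I -> Xi, (forall i, A i -> (mdist (f i) (f' i) < e)%R) -> U f'].
Proof.
split; last first.
  move=> [A [e [fA e0 hU]]].
  apply: (@filterS _ _ _ [set f' : {ptws I -> Xi} |
      forall i, A i -> (mdist (f i) (f' i) < e)%R]); first by move=> f'; exact: hU.
  apply: filter_forall_finite => // i _.
  have /(_ [set y | (mdist (f i) y < e)%R]) := @proj_continuous I (fun=> Xi) i f.
  by apply; rewrite -ballEmdist; exact: nbhsx_ballx.
(* The sets of this form are a filter. Convergence in the product topology is tested on each
   coordinate, so this filter converges to [f] and contains every neighbourhood of [f]. *)
pose F := [set U : set {ptws I -> Xi} | exists A e, [/\ finite_set A, (0 < e)%R &
    forall f' : I -> Xi, (forall i, A i -> (mdist (f i) (f' i) < e)%R) -> U f']].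
have FF : Filter F.
  split.
  - by exists set0, 1%R.
  - move=> P Q [A [e [fA e0 hP]]] [B [d [fB d0 hQ]]].
    exists (A `|` B), (Num.min e d); rewrite finite_setU lt_min e0 d0; split => //.
    move=> f' h; split; [apply: hP|apply: hQ] => i iA.
      by have := h i (or_introl iA); rewrite lt_min => /andP[].
    by have := h i (or_intror iA); rewrite lt_min => /andP[].
  - by move=> P Q PQ [A [e [fA e0 hP]]]; exists A, e; split=> // f' /hP /PQ.
suff : cvg_to F (nbhs f) by apply.
apply/cvg_sup => i V; rewrite nbhsE => -[_ [[W oW <-] Wf] /= WV].
have /nbhs_ballP[e /= e0 eW] : nbhs (f i) W by exact: open_nbhs_nbhs.
exists [set i], e; split => // f' /(_ i erefl) h; apply/WV/eW.
by rewrite ballEmdist.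
Qed.

Variable G : multigraph.
Implicit Types w : marking Xi G.

Definition mark_close (A : set (vertex G)) (B : set (dart G)) (e : R) w w' :=
  (forall x, A x -> (mdist (vmark w x) (vmark w' x) < e)%R) /\
  (forall d, B d -> (mdist (dmark w d) (dmark w' d) < e)%R).

Lemma mark_closeS A A' B B' e e' w w' : A `<=` A' -> B `<=` B' -> (e' <= e)%R ->
  mark_close A' B' e' w w' -> mark_close A B e w w'.
Proof.
move=> AA BB ee [hA hB]; split=> [x /AA /hA|d /BB /hB] h; exact: lt_le_trans h ee.
Qed.

Lemma nbhs_marking w (U : set (marking Xi G)) :
  nbhs w U <-> exists A B e, [/\ finite_set A, finite_set B, (0 < e)%R &
    forall w', mark_close A B e w w' -> U w'].
Proof.
split.
  move=> [[P Q] /= [/nbhs_ptws[A [e [fA e0 hP]]] /nbhs_ptws[B [d [fB d0 hQ]]]] PQU].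
  exists A, B, (Num.min e d); rewrite lt_min e0 d0; split => // w' [hA hB].
  apply: PQU; split => /=; [apply: hP => x xA|apply: hQ => x xA].
    by have := hA x xA; rewrite lt_min => /andP[].
  by have := hB x xA; rewrite lt_min => /andP[].
move=> [A [B [e [fA fB e0 hU]]]].
exists ([set f | forall x, A x -> (mdist (w.1 x) (f x) < e)%R],
        [set f | forall x, B x -> (mdist (w.2 x) (f x) < e)%R]) => /=.
  by split; apply/nbhs_ptws; [exists A, e|exists B, e].
by move=> [w1 w2] [/= h1 h2]; exact: hU.
Qed.

Lemma open_markingP (U : set (marking Xi G)) :
  open U <-> forall w, U w -> exists A B e,
    [/\ finite_set A, finite_set B, (0 < e)%R &
        forall w', mark_close A B e w w' -> U w'].
Proof. by rewrite openE; split => h g /h => [/nbhs_marking|/nbhs_marking]. Qed.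

End marking_topology.

Section transport_continuity.
Context {R : realType} {Xi : completeMetricType R} {G : multigraph}.

Lemma transport_continuous (g : aut G) : continuous (@transport Xi G G g).
Proof.
apply/continuousP => U /open_markingP oU; apply/open_markingP => w /oU.
move=> [A [B [e [fA fB e0 hU]]]].
exists (isoV_inv g @` A), (isoD_inv g @` B), e; split => //; [exact: finite_image..|].
by move=> w' [hA hB]; apply: hU; split => x xA; [apply: hA|apply: hB]; exists x.
Qed.

(** [transport] involves inverses, while the topology of [aut G] tests the forward maps; this passes
    from one to the other. *)
Lemma isoV_inv_agree (g h : aut G) (A : set (vertex G)) :
  (forall x, (isoV_inv g @` A) x -> isoV h x = isoV g x) ->
  forall x, A x -> isoV_inv h x = isoV_inv g x.
Proof.
move=> gh x xA; have e : isoV h (isoV_inv g x) = x.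
  by rewrite gh ?isoV_invK//; exists x.
by rewrite -{1}e isoVK.
Qed.

Lemma isoD_inv_agree (g h : aut G) (A : set (dart G)) :
  (forall x, (isoD_inv g @` A) x -> isoD h x = isoD g x) ->
  forall x, A x -> isoD_inv h x = isoD_inv g x.
Proof.
move=> gh x xA; have e : isoD h (isoD_inv g x) = x.
  by rewrite gh ?isoD_invK//; exists x.
by rewrite -{1}e isoDK.
Qed.

End transport_continuity.

Lemma transport_continuous_aut (R : realType) (Xi : completeMetricType R)
    (G : graph) (w : marking Xi G) :
  continuous (fun g : aut G => transport g w).
Proof.
apply/continuousP => U /open_markingP oU; apply/open_autP => g /oU.
move=> [A [B [e [fA fB e0 hU]]]].
exists (isoV_inv g @` A), (isoD_inv g @` B); split; [exact: finite_image..|].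
move=> h hA hB; apply: hU; split => x xA /=.
  by rewrite /vmark /= (isoV_inv_agree hA)// mdistxx.
by rewrite /dmark /= (isoD_inv_agree hB)// mdistxx.
Qed.

Section marking_measurability.
Context {R : realType} {Xi : completeMetricType R} {G : graph}.

Lemma measurable_transport (g : aut G) :
  measurable_fun setT (transport g : borel (marking Xi G) -> borel (marking Xi G)).
Proof. exact: continuous_borel (@transport_continuous R Xi G g). Qed.

Lemma measurable_transport_aut (w : marking Xi G) :
  measurable_fun setT
    ((fun g => transport g w) : borel (aut G) -> borel (marking Xi G)).
Proof. exact: continuous_borel (@transport_continuous_aut R Xi G w). Qed.

End marking_measurability.

(** * Topology of the space of networks *)

Section network_space.
Context {R : realType} {Xi : completeMetricType R}.

Lemma net_classP k (N M : rooted_network Xi k) :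
  net_class N = net_class M <-> network_iso N M.
Proof.
split; first by move=> /eqmodP/asboolP.
by move=> NM; apply/eqmodP/asboolP.
Qed.

Lemma net_reprK k (c : net_space Xi k) : net_class (net_repr c) = c.
Proof. exact: reprK. Qed.

(** Unfolds the quotient topology: the preimage of [U] under [net_class] is open in the space of
    networks. *)
Lemma open_netP k (U : set (net_space Xi k)) : open U <->
  forall N, U (net_class N) -> exists r e, (0 < e)%R /\
    forall M, locally_close r e N M -> U (net_class M).
Proof. by []. Qed.

Lemma locally_closeP k r e (N M : rooted_network Xi k) :
  locally_close r e N M <-> exists fV fD,
    [/\ ball_iso (nroots N) (nroots M) r fV fD,
        forall x, tball (nroots N) r x ->
          (mdist (vmark (nmark N) x) (vmark (nmark M) (fV x)) < e)%R &
        forall d, idarts (tball (nroots N) r) d ->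
          (mdist (dmark (nmark N) d) (dmark (nmark M) (fD d)) < e)%R].
Proof.
split; first by move=> [fV [fD [[bV bD] hD hr hm hm']]]; exists fV, fD; split.
by move=> [fV [fD [[[bV bD hD] hr] hm hm']]]; exists fV, fD; split.
Qed.

Lemma net_class_continuous (G : graph) k (z : k.-tuple (vertex G)) :
  continuous (fun w : marking Xi G => net_class (RootedNetwork w z)).
Proof.
apply/continuousP => U /open_netP oU; apply/open_markingP => w /oU.
move=> [r [e [e0 hU]]]; exists (tball z r), (idarts (tball z r)), e; split => //.
- exact: tball_finite.
- apply: idarts_finite (tball_finite _ _); exact: graph_locally_finite.
move=> w' [hA hB]; apply: hU; apply/locally_closeP.
exists id, id; split => //.
have := iso_ball_iso (iso_id G) z r; congr (ball_iso _ _ _ _ _).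
by apply: eq_from_tnth => i; rewrite tnth_map.
Qed.

Lemma measurable_net_class (G : graph) k (z : k.-tuple (vertex G)) :
  measurable_fun setT ((fun w => net_class (RootedNetwork w z)) :
    borel (marking Xi G) -> borel (net_space Xi k)).
Proof. exact: continuous_borel (@net_class_continuous G k z). Qed.

Lemma ball_iso_reroot (G H : multigraph) k l (x : k.-tuple (vertex G))
    (y : k.-tuple (vertex H)) (x' : l.-tuple (vertex G)) r s fV fD :
  ball_iso x y (s + r) fV fD -> range (tnth x') `<=` tball x s ->
  ball_iso x' (map_tuple fV x') r fV fD.
Proof.
move=> fi x's; split => //.
rewrite [X in partial_iso _ X](_ : _ = fV @` tball x' r).
  apply: partial_iso_sub fi.1; rewrite /tball -gballD; exact: gball_subset.
by rewrite (ball_iso_gball fi x's)// /tball range_tnth_map.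
Qed.

(** Moving the roots within distance [s] costs [s] in the radius. Hence closeness of rooted networks
    controls the birooted networks whose second root is near the first. *)
Lemma locally_close_reroot k l (N M : rooted_network Xi k) r s e fV fD
    (x' : l.-tuple (vertex (ngraph N))) :
  ball_iso (nroots N) (nroots M) (s + r) fV fD ->
  (forall x, tball (nroots N) (s + r) x ->
    (mdist (vmark (nmark N) x) (vmark (nmark M) (fV x)) < e)%R) ->
  (forall d, idarts (tball (nroots N) (s + r)) d ->
    (mdist (dmark (nmark N) d) (dmark (nmark M) (fD d)) < e)%R) ->
  range (tnth x') `<=` tball (nroots N) s ->
  locally_close r e (RootedNetwork (nmark N) x')
    (RootedNetwork (nmark M) (map_tuple fV x')).
Proof.
move=> fi hV hD x's; apply/locally_closeP; exists fV, fD; split.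
- exact: ball_iso_reroot fi x's.
- by move=> x xr; apply: hV; rewrite /tball -gballD; exact: gball_subset xr.
- move=> d dr; apply: hD; apply: idartsS dr; rewrite /tball -gballD.
  exact: gball_subset.
Qed.

Lemma root_birooted (N M : rooted_network Xi 1) f (x : vertex (ngraph N)) :
  map_tuple f (nroots N) = nroots M ->
  map_tuple f [tuple root N; x] = [tuple root M; f x].
Proof.
move=> fNM; apply: val_inj => /=; congr [:: _; _].
by rewrite /root -fNM /thead tnth_map.
Qed.

Lemma nroots_root (N : rooted_network Xi 1) : nroots N = [tuple root N].
Proof. by apply: eq_from_tnth => i; rewrite !ord1. Qed.

Lemma birooted_iso (N M : rooted_network Xi 1) (f : iso (ngraph N) (ngraph M)) x y :
  transport f (nmark N) = nmark M ->
  birooted x y = birooted (isoV f x) (isoV f y).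
Proof.
move=> fm; apply/net_classP; exists f; split => //.
exact: val_inj.
Qed.

Lemma iso_bij_vertex (G H : multigraph) (f : iso G H) :
  set_bij [set: vertex G] [set: vertex H] (isoV f).
Proof. by case: (iso_partial_iso f). Qed.

Lemma network_iso_root (N M : rooted_network Xi 1) (f : iso (ngraph N) (ngraph M)) :
  map_tuple (isoV f) (nroots N) = nroots M -> isoV f (root N) = root M.
Proof. by move=> fr; rewrite /root -fr /thead tnth_map. Qed.

(** An isomorphism from [N] to the chosen representative reindexes the sum and preserves the
    birooted classes. *)
Lemma esum_birooted_out (N : rooted_network Xi 1)
    (f : Gstarstar Xi -> \bar R) (M := net_repr (net_class N)) :
  \esum_(x in [set: vertex (ngraph M)]) f (birooted (root M) x) =
  \esum_(x in [set: vertex (ngraph N)]) f (birooted (root N) x).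
Proof.
have /net_classP[g [gm gr]] : net_class N = net_class M by rewrite net_reprK.
rewrite (reindex_esum _ _ _ _ (iso_bij_vertex g)); apply: eq_esum => x _.
by rewrite -(network_iso_root gr) -(birooted_iso _ _ gm).
Qed.

Lemma esum_birooted_in (N : rooted_network Xi 1)
    (f : Gstarstar Xi -> \bar R) (M := net_repr (net_class N)) :
  \esum_(x in [set: vertex (ngraph M)]) f (birooted x (root M)) =
  \esum_(x in [set: vertex (ngraph N)]) f (birooted x (root N)).
Proof.
have /net_classP[g [gm gr]] : net_class N = net_class M by rewrite net_reprK.
rewrite (reindex_esum _ _ _ _ (iso_bij_vertex g)); apply: eq_esum => x _.
by rewrite -(network_iso_root gr) -(birooted_iso _ _ gm).
Qed.

End network_space.

(** The largest of the radii and the smallest of the tolerances serve all [i] at once, by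
    monotonicity of [Q]. *)
Lemma finite_uniform (R : realType) (I : eqType) (X : set I) (Q : I -> nat -> R -> Prop) :
  finite_set X ->
  (forall i r r' e e', (r <= r')%N -> (e' <= e)%R -> Q i r e -> Q i r' e') ->
  (forall i, X i -> exists r e, (0 < e)%R /\ Q i r e) ->
  exists r e, (0 < e)%R /\ forall i, X i -> Q i r e.
Proof.
move=> /finite_seqP[s ->] Qmono; elim: s => [_|i s IH h].
  by exists 0%N, 1%R; split => // i; rewrite /= in_nil.
have [|r [e [e0 hs]]] := IH.
  by move=> j /= js; apply: h; rewrite /= inE js orbT.
have [|r' [e' [e'0 hi]]] := h i; first by rewrite /= inE eqxx.
exists (maxn r r'), (Num.min e e'); rewrite lt_min e0 e'0; split => // j.
rewrite /= inE => /predU1P[->|js].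
  by apply: Qmono hi; rewrite ?leq_maxr// ge_min lexx orbT.
by apply: Qmono (hs _ js); rewrite ?leq_maxl// ge_min lexx.
Qed.

Lemma borel_lsc_measurable (R : realType) d (X : measurableType d) (f : X -> \bar R) :
  (forall t : R, measurable [set x | t%:E < f x]) -> measurable_fun setT f.
Proof.
move=> mf; apply: (measurability _ (ErealGenOInfty.measurableE R)).
move=> _ [_ [t ->] <-]; rewrite setTI.
rewrite (_ : _ @^-1` _ = [set x | t%:E < f x])//.
by apply/seteqP; split => x /=; rewrite in_itv/= andbT.
Qed.

(** * Measurability of sums over the vertices *)

Section vertex_sums.
Context {R : realType} {Xi : completeMetricType R}.

(* Spheres, rather than balls, so that the sum over all vertices splits into
   finite sums. *)
Definition sphere (N : rooted_network Xi 1) : nat -> set (vertex (ngraph N)) :=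
  seqD (tball (nroots N)).
Arguments sphere : clear implicits.

Lemma tball_ndecr (N : rooted_network Xi 1) :
  {homo tball (nroots N) : n m / (n <= m)%N >-> (n <= m)%O}.
Proof. by move=> n m nm; apply/subsetPset; exact: gballS. Qed.

Lemma sphere_sub (N : rooted_network Xi 1) n : sphere N n `<=` tball (nroots N) n.
Proof. by case: n => [//|n] x []. Qed.

Lemma ball_iso_sphere (N M : rooted_network Xi 1) n r fV fD x : (n <= r)%N ->
  ball_iso (nroots N) (nroots M) r fV fD -> sphere N n x -> sphere M n (fV x).
Proof.
move=> nr fi.
have im m : (m <= n)%N -> tball (nroots N) m x -> tball (nroots M) m (fV x).
  by move=> mn xm; rewrite -(ball_iso_tball fi (leq_trans mn nr)); exists x.
case: n nr im => [_ im|n nr im [xn xn']]; first exact: im.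
split; first exact: im.
rewrite -(ball_iso_tball fi (ltnW nr)) => -[x' x'n xx']; apply: xn'.
have [[[_ iV _] _ _] _] := fi.
rewrite -(iV x' x) ?inE//; first exact: gballS (ltnW nr) _ x'n.
exact: gballS nr _ xn.
Qed.

(** The sum counts the [x] on the sphere whose class is in [U]. Each of these finitely many [x]
    keeps its class in [U] under small changes of the network, and a ball isomorphism carries them
    injectively to the sphere of [M]. *)
Lemma sphere_lsc (N : rooted_network Xi 1) n (U : set (Gstarstar Xi)) : open U ->
  exists r e, (0 < e)%R /\ forall M, locally_close r e N M ->
    \esum_(x in sphere N n) \d_(birooted (root N) x : borel (Gstarstar Xi)) U <=
    \esum_(x in sphere M n) (\d_(birooted (root M) x : borel (Gstarstar Xi)) U : \bar R).
Proof.
move=> oU.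
pose X (N : rooted_network Xi 1) := [set x | U (birooted (root N) x)].
have sumX M : \esum_(x in sphere M n)
      (\d_(birooted (root M) x : borel (Gstarstar Xi)) U : \bar R) =
    \esum_(x in sphere M n `&` X M) 1.
  rewrite [RHS]esum_mkcondr; apply: eq_esum => x _; rewrite diracE.
  have -> : (birooted (root M) x \in U) = (x \in X M) by apply/idP/idP; rewrite !inE.
  by case: (x \in X M).
pose Q (x : vertex (ngraph N)) r (e : R) := forall M : rooted_network Xi 2,
  locally_close r e (RootedNetwork (nmark N) [tuple root N; x]) M -> U (net_class M).
have [|||r [e [e0 hQ]]] := @finite_uniform R _ (sphere N n `&` X N) Q.
- by apply/finite_setIl/(sub_finite_set (@sphere_sub N n))/tball_finite.
- by move=> i r r' e e' rr ee h M /(locally_closeW rr ee)/h.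
- by move=> x [_ /oU]; exact.
(* Balls of radius [r] around vertices at distance at most [n] from the root have to be matched. *)
exists (n + r)%N, e; split => // M /locally_closeP[fV [fD [fi hV hD]]].
have [[[_ iV _] _ _] fr] := fi.
rewrite !sumX -(@esum_image _ _ _ (sphere N n `&` X N) fV (fun=> 1)).
  apply: le_esum_subset => // _ [x [xn xX] <-]; split.
    by apply: ball_iso_sphere fi xn; exact: leq_addr.
  apply: (hQ x) => //=; rewrite -(root_birooted _ fr).
  apply: locally_close_reroot fi hV hD _ => y [i _ <-].
  have : tnth [tuple root N; x] i \in [tuple root N; x] by exact: mem_tnth.
  rewrite !inE => /orP[/eqP ->|/eqP ->]; last exact: sphere_sub.
  by apply: gball_sub; exists ord0.
move=> x y; rewrite !inE => -[/sphere_sub xn _] [/sphere_sub yn _].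
by apply: iV; rewrite inE; apply: gballS (leq_addr _ _) _ _.
Qed.

Lemma network_iso_close k r e (N M : rooted_network Xi k) : (0 < e)%R ->
  network_iso N M -> locally_close r e N M.
Proof.
move=> e0 [f [fm fr]]; apply/locally_closeP; exists (isoV f), (isoD f); split.
- by rewrite -fr; exact: iso_ball_iso.
- by move=> x _; rewrite -fm /transport /vmark /= isoVK mdistxx.
- by move=> d _; rewrite -fm /transport /dmark /= isoDK mdistxx.
Qed.

(** Isomorphic networks are close at every scale, so [sphere_lsc] applies in both directions. *)
Lemma sphere_out (N : rooted_network Xi 1) n (U : set (Gstarstar Xi))
    (M := net_repr (net_class N)) : open U ->
  \esum_(x in sphere M n)
    (\d_(birooted (root M) x : borel (Gstarstar Xi)) U : \bar R) =
  \esum_(x in sphere N n) \d_(birooted (root N) x : borel (Gstarstar Xi)) U.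
Proof.
move=> oU; have le N1 N2 : network_iso N1 N2 ->
    \esum_(x in sphere N1 n)
      (\d_(birooted (root N1) x : borel (Gstarstar Xi)) U : \bar R) <=
    \esum_(x in sphere N2 n) \d_(birooted (root N2) x : borel (Gstarstar Xi)) U.
  by have [r [e [e0 h]]] := sphere_lsc N1 n oU => /(network_iso_close r e0)/h.
by apply/eqP; rewrite eq_le !le//; apply/net_classP; rewrite net_reprK.
Qed.

(** On each sphere the sum is the integral of [f] against a finite sum of Dirac masses, a kernel
    that is lower semicontinuous on open sets by [sphere_lsc]. The spheres partition the vertices,
    which leaves a series over the radius. *)
Lemma measurable_vertex_sum (f : borel (Gstarstar Xi) -> \bar R) :
  measurable_fun setT f -> (forall z, 0 <= f z) ->
  measurable_fun setT (fun c : borel (Gstar Xi) => let N := net_repr c in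
    \esum_(x in [set: vertex (ngraph N)]) f (birooted (root N) x)).
Proof.
move=> mf f0.
have csph (N : rooted_network Xi 1) n : countable (sphere N n).
  exact: sub_countable (subset_card_le (@subsetT _ _)) (countable_vertex _).
pose k n (c : borel (Gstar Xi)) := sval (cid (esum_measure (csph (net_repr c) n)
  (fun x => \d_(birooted (root (net_repr c)) x : borel (Gstarstar Xi)) :
     {measure set (borel (Gstarstar Xi)) -> \bar R}))).
have kE n c A : k n c A = \esum_(x in sphere (net_repr c) n)
    \d_(birooted (root (net_repr c)) x : borel (Gstarstar Xi)) A.
  by rewrite /k; case: cid => m /= [].
have kI n c : \int[k n c]_z f z = \esum_(x in sphere (net_repr c) n)
    f (birooted (root (net_repr c)) x).
  rewrite /k; case: cid => m /= [_ ->]//; apply: eq_esum => x _.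
  by rewrite integral_dirac// diracT mul1e.
rewrite (_ : (fun _ => _) = fun c => \sum_(n <oo) \int[k n c]_z f z).
  apply: ge0_emeasurable_sum => [n c _ _|n _]; first exact: integral_ge0.
  apply: measurable_fun_integral_kernel => //.
  apply: borel_kernel_measurable.
    move=> c; have fsph := sub_finite_set (@sphere_sub (net_repr c) n) (tball_finite _ _).
    rewrite kE esum_fset// fsbig_finite//; apply: lte_sum_pinfty => x _.
    by rewrite diracT ltry.
  move=> U oU; apply: borel_lsc_measurable => t; apply: borel_open.
  apply/open_netP => N; rewrite /= kE (sphere_out _ _ oU) => tN.
  have [r [e [e0 h]]] := sphere_lsc N n oU.
  exists r, e; split => // M /h; rewrite kE (sphere_out _ _ oU).
  exact: lt_le_trans.
apply/funext => c /=; under eq_eseriesr do rewrite kI.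
rewrite -nneseries_sum_bigcup//; last exact/trivIset_seqD/tball_ndecr.
rewrite eq_bigcup_seqD; congr (esum _ _); apply/seteqP; split => // x _.
by have [r xr] := tball_cover (nroots (net_repr c)) x; exists r.
Qed.

End vertex_sums.

(** * Mass transport on the graph *)

Section haar_sums.
Context {R : realType} {G : graph}.
Variable haar : {measure set (borel (aut G)) -> \bar R}.
Hypotheses (haarP : is_haar haar) (rinv : right_invariant haar).
Implicit Types (x y : vertex G) (g : aut G) (A : set (borel (aut G))).

Lemma esum_haar_target A x : measurable A ->
  \esum_(y in [set: vertex G]) haar (A `&` [set g | isoV g x = y]) = haar A.
Proof.
move=> mA; rewrite -measure_esum_bigcup.
- rewrite -setI_bigcupr (_ : \bigcup_y _ = setT) ?setIT//.
  by apply/seteqP; split => // g _; exists (isoV g x).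
- exact: countable_vertex.
- by move=> y; apply: measurableI mA (measurable_isoV _ _).
- by move=> y y' _ _ [g [[_ /= <-] [_ <-]]].
Qed.

Lemma esum_haar_source A y : measurable A ->
  \esum_(x in [set: vertex G]) haar (A `&` [set g | isoV g x = y]) = haar A.
Proof.
move=> mA; rewrite -measure_esum_bigcup.
- rewrite -setI_bigcupr (_ : \bigcup_x _ = setT) ?setIT//.
  by apply/seteqP; split => // g _; exists (isoV_inv g y); rewrite //= isoV_invK.
- exact: countable_vertex.
- by move=> x; apply: measurableI mA (measurable_isoV _ _).
- by move=> x x' _ _ [g [[_ /= <-] [_ /(congr1 (isoV_inv g))]]]; rewrite !isoVK.
Qed.

Variable S : set (vertex G).
Hypothesis sectionS : complete_section S.

Lemma haar_stabV_ge0 x : 0 <= (haar (@stab G x))^-1.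
Proof. by rewrite inve_ge0. Qed.

Lemma haar_stabVK x : (haar (@stab G x))^-1 * haar (@stab G x) = 1.
Proof. by rewrite mulVe ?gt_eqF ?haar_stab_gt0// haar_stab_fin_num. Qed.

(** Only the representative [u] of the orbit of [x] contributes, and its set is a right coset of the
    stabilizer of [u]. *)
Lemma esum_section_target x :
  \esum_(o in S) (haar (@stab G o))^-1 * haar [set g | isoV g x = o] = 1.
Proof.
have [u [[Su [g gx]] uo]] := sectionS x; rewrite (esum_single Su).
- by rewrite -gx haar_isoV_right// haar_stabVK.
- by move=> j _; rewrite mule_ge0 ?haar_stabV_ge0.
- move=> j Sj ju; rewrite (_ : [set g | _] = set0) ?measure0 ?mule0//.
  by apply/seteqP; split => // h hx; apply: ju; apply/esym/uo; split => //; exists h.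
Qed.

(** Only the representative [u] of the orbit of [y] contributes, and its set is a left coset of the
    stabilizer of [u]. *)
Lemma esum_section_source y :
  \esum_(o in S) (haar (@stab G o))^-1 * haar [set g | isoV g o = y] = 1.
Proof.
have [u [[Su [g gy]] uo]] := sectionS y; rewrite (esum_single Su).
- have -> : y = isoV (iso_inv g) u by rewrite -gy /= isoVK.
  by rewrite haar_isoV_left// haar_stabVK.
- by move=> j _; rewrite mule_ge0 ?haar_stabV_ge0.
- move=> j Sj ju; rewrite (_ : [set g | _] = set0) ?measure0 ?mule0//.
  apply/seteqP; split => // h hx; apply: ju; apply/esym/uo; split => //.
  by exists (iso_inv h); rewrite -hx /= isoVK.
Qed.

Lemma section_mass_transport (phi : vertex G -> vertex G -> \bar R) :
  (forall x y, 0 <= phi x y) ->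
  (forall g x y, phi (isoV g x) (isoV g y) = phi x y) ->
  \esum_(o in S) (haar (@stab G o))^-1 * (\esum_(x in [set: vertex G]) phi o x) =
  \esum_(o in S) (haar (@stab G o))^-1 * (\esum_(x in [set: vertex G]) phi x o).
Proof.
move=> phi0 phig.
pose w x := (haar (@stab G x))^-1.
have w0 x : 0 <= w x by exact: haar_stabV_ge0.
pose q x y x' y' := haar ([set g | isoV g x = x'] `&` [set g | isoV g y = y']).
have q_ge0 x y x' y' : 0 <= q x y x' y' by exact: measure_ge0.
pose s : set (vertex G) := setT.
have cV : countable s by exact: countable_vertex.
have cS : countable S by apply: sub_countable cV; exact: subset_card_le.
(* Summing over [y] removes the condition [g o = y]; the sum over [o1] is then the partition of
   unity at [x]. *)
have L o x : w o * phi o x = \esum_(o1 in S) \esum_(y in s)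
    w o * phi o x * (w o1 * q o x y o1).
  under eq_esum => o1 _.
    rewrite esumZl//; [|exact: mule_ge0|by move=> y; exact: mule_ge0].
    rewrite esumZl//.
    under eq_esum do rewrite /q setIC.
    rewrite esum_haar_target; last exact: measurable_isoV.
    over.
  rewrite esumZl//; [|exact: mule_ge0|by move=> o1; exact: mule_ge0].
  by rewrite esum_section_target mule1.
have Rr y o1 : w o1 * phi y o1 = \esum_(o in S) \esum_(x in s)
    w o * phi o x * (w o1 * q o x y o1).
  transitivity (\esum_(o in S) \esum_(x in s) w o1 * phi y o1 * (w o * q o x y o1)).
    under eq_esum => o _.
      rewrite esumZl//; [|exact: mule_ge0|by move=> x; exact: mule_ge0].
      rewrite esumZl// esum_haar_source; last exact: measurable_isoV.
      over.
    rewrite esumZl//; [|exact: mule_ge0|by move=> o; exact: mule_ge0].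
    by rewrite esum_section_source mule1.
  apply: eq_esum => o _; apply: eq_esum => x _.
  (* Where [q] is nonzero, some [g] has [g o = y] and [g x = o1], so [phi o x = phi y o1] by
     invariance. *)
  have [q_0|/eqP qn0] := eqVneq (q o x y o1) 0.
    by rewrite q_0 !mule0.
  have [g [/= gy go1]] : exists g, ([set g | isoV g o = y] `&` [set g | isoV g x = o1]) g.
    by apply/set0P/eqP => e; apply: qn0; rewrite /q e measure0.
  by rewrite -gy -go1 phig muleACA [w _ * w _]muleC muleACA.
transitivity (\esum_(o in S) \esum_(x in s) \esum_(o1 in S) \esum_(y in s)
    w o * phi o x * (w o1 * q o x y o1)).
  apply: eq_esum => o _; rewrite -(esumZl cV)//; last exact: w0.
  by apply: eq_esum => x _; exact: L.
transitivity (\esum_(o1 in S) \esum_(y in s) \esum_(o in S) \esum_(x in s)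
    w o * phi o x * (w o1 * q o x y o1)); last first.
  apply: eq_esum => o1 _; rewrite -(esumZl cV)//; last exact: w0.
  by apply: eq_esum => y _; rewrite -Rr.
have t0 o x o1 y : 0 <= w o * phi o x * (w o1 * q o x y o1).
  by rewrite !mule_ge0.
under eq_esum => o _.
  rewrite exchange_esum; last by move=> *; exact: esum_ge0.
  under eq_esum => o1 _ do rewrite exchange_esum//.
  over.
rewrite exchange_esum; last by move=> *; apply: esum_ge0 => *; exact: esum_ge0.
by apply: eq_esum => o1 _; rewrite exchange_esum// => *; exact: esum_ge0.
Qed.

End haar_sums.

(** * Random rooting *)

Section swap_roots.
Context {R : realType} {Xi : completeMetricType R}.

(** Exchanging the roots turns incoming sums into outgoing ones, so that measurability of the former
    follows from that of the latter. *)
Definition swap_roots (c : Gstarstar Xi) : Gstarstar Xi :=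
  let N := net_repr c in
  net_class (RootedNetwork (nmark N) [tuple of seq.rev (nroots N)]).

Lemma swap_net_class (N : rooted_network Xi 2) :
  swap_roots (net_class N) =
  net_class (RootedNetwork (nmark N) [tuple of seq.rev (nroots N)]).
Proof.
have /net_classP[f [fm fr]] : net_class N = net_class (net_repr (net_class N)).
  by rewrite net_reprK.
apply/esym/net_classP; exists f; split => //=; apply: val_inj => /=.
by rewrite map_rev -fr.
Qed.

Lemma swap_birooted (N : rooted_network Xi 1) (x y : vertex (ngraph N)) :
  swap_roots (birooted x y) = birooted y x.
Proof.
by rewrite swap_net_class; congr net_class; congr RootedNetwork; exact: val_inj.
Qed.

Lemma swap_roots_continuous : continuous swap_roots.
Proof.
apply/continuousP => U /open_netP oU; apply/open_netP => N.
rewrite /= swap_net_class => /oU[r [e [e0 hU]]]; exists r, e; split => // M.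
move=> /locally_closeP[fV [fD [fi hV hD]]]; rewrite /= swap_net_class.
have -> : [tuple of seq.rev (nroots M)] = map_tuple fV [tuple of seq.rev (nroots N)].
  by apply: val_inj; rewrite /= map_rev -fi.2.
apply: hU; apply: (@locally_close_reroot _ _ _ _ N M r 0 e fV fD) => //.
move=> x [i _ <-]; have : tnth [tuple of seq.rev (nroots N)] i \in nroots N.
  by rewrite -mem_rev; exact: mem_tnth.
by move=> /tnthP[j ->]; exists j.
Qed.

Lemma measurable_swap_roots :
  measurable_fun setT (swap_roots : borel (Gstarstar Xi) -> borel (Gstarstar Xi)).
Proof. exact: continuous_borel swap_roots_continuous. Qed.

Lemma measurable_vertex_sum_in (f : borel (Gstarstar Xi) -> \bar R) :
  measurable_fun setT f -> (forall z, 0 <= f z) ->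
  measurable_fun setT (fun c : borel (Gstar Xi) => let N := net_repr c in
    \esum_(x in [set: vertex (ngraph N)]) f (birooted x (root N))).
Proof.
move=> mf f0.
have := @measurable_vertex_sum _ _ (f \o swap_roots)
  (measurableT_comp mf measurable_swap_roots) (fun z => f0 _).
congr measurable_fun; apply/funext => c /=; apply: eq_esum => x _.
by rewrite swap_birooted.
Qed.

End swap_roots.

Section total_mass_one.
Context d (T : measurableType d) (R : realType).
Variable m : {measure set T -> \bar R}.

(* The proof is an unused argument so that the instances below can find it. *)
Definition unit_mass of m setT = 1 : set T -> \bar R := m.

Variable m1 : m setT = 1.

HB.instance Definition _ := Measure.copy (unit_mass m1) m.
HB.instance Definition _ := Measure_isProbability.Build _ _ _ (unit_mass m1) m1.

End total_mass_one.

Section random_rooting_unimodular.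
Context {R : realType} {Xi : completeMetricType R} {G : graph}.
Variable haar : {measure set (borel (aut G)) -> \bar R}.
Hypotheses (haarP : is_haar haar) (rinv : right_invariant haar).
Variable S : set (vertex G).
Hypotheses (sectionS : complete_section S) (finite_weight : total_weight haar S < +oo).
Variable nu : probability (borel (marking Xi G)) R.
Hypothesis nu_inv : aut_invariant nu.

Lemma total_weight_gt0 : 0 < total_weight haar S.
Proof.
have [x] := graph_inhabited G; have [u [[Su _] _]] := sectionS x.
apply: (@lt_le_trans _ _ (haar (@stab G u))^-1).
  have h0 := haar_stab_gt0 haarP u; have hy := haar_stab_lty haarP u.
  by rewrite inve_gt0 ?(gt_eqF h0) ?(lt_eqF hy).
rewrite -(@esum_set1 R _ u (fun u => (haar (@stab G u))^-1)); last first.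
  exact: haar_stabV_ge0.
apply: le_esum_subset => [_ ->//|i]; exact: haar_stabV_ge0.
Qed.

Definition rooting_weight (x : vertex G) : \bar R :=
  (total_weight haar S)^-1 * (haar (@stab G x))^-1.

Lemma rooting_weight_ge0 x : 0 <= rooting_weight x.
Proof. by apply: mule_ge0; rewrite inve_ge0 ?(ltW total_weight_gt0). Qed.

Lemma rooting_weight_lty x : rooting_weight x < +oo.
Proof.
have h0 := haar_stab_gt0 haarP x; have t0 := total_weight_gt0.
rewrite -ge0_fin_numE ?rooting_weight_ge0//.
by rewrite fin_numM// fin_numV ?(gt_eqF h0) ?(gt_eqF t0)// gt_eqF//
  (lt_trans _ h0, lt_trans _ t0).
Qed.

Lemma esum_rooting_weight : \esum_(u in S) rooting_weight u = 1.
Proof.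
have cS : countable S.
  by apply: sub_countable (@countable_vertex G); exact: subset_card_le.
rewrite esumZl//.
- by rewrite mulVe ?(gt_eqF total_weight_gt0)// ge0_fin_numE// ltW// total_weight_gt0.
- by rewrite inve_ge0 (ltW total_weight_gt0).
- by move=> x; rewrite haar_stabV_ge0.
Qed.

Lemma integral_aut_invariant (g : aut G) (F : borel (marking Xi G) -> \bar R) :
  measurable_fun setT F -> (forall w, 0 <= F w) ->
  \int[nu]_w F (transport g w) = \int[nu]_w F w.
Proof.
move=> mF F0.
have [m [mE mI]] := scaled_pushforward nu (measurable_transport g) lee01 (ltry 1).
rewrite -[LHS]mul1e -mI//; apply: eq_measure_integral => A mA _.
by rewrite mE mul1e; exact: nu_inv.
Qed.

Lemma random_rooting_unimodular : exists mu : probability (borel (Gstar Xi)) R,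
  (forall B, measurable B -> mu B = random_rooting haar S nu B) /\
  unimodular_measure mu.
Proof.
have cV := @countable_vertex G.
have cS : countable S by apply: sub_countable cV; exact: subset_card_le.
(* [mu] will be the sum over [u] in [S] of the images of [nu] under rooting at [u], scaled by the
   weight of [u]. *)
have m_ u := cid (scaled_pushforward nu (measurable_net_class (Xi := Xi) [tuple u])
  (rooting_weight_ge0 u) (rooting_weight_lty u)).
have [mu [muE muI]] := esum_measure cS (fun u => sval (m_ u)).
have mu1 : mu setT = 1.
  rewrite muE -[RHS]esum_rooting_weight; apply: eq_esum => u _.
  by case: (m_ u) => m /= [-> _]; rewrite preimage_setT probability_setT mule1.
exists (unit_mass mu1); split.
  move=> B mB; rewrite -[LHS]/(mu B) muE; apply: eq_esum => u _.
  by case: (m_ u) => m /= [-> _].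
move=> f mf f0.
pose phi x y := \int[nu]_w f (net_class (RootedNetwork w [tuple x; y])).
have mphi x y : measurable_fun setT
    (fun w : borel (marking Xi G) => f (net_class (RootedNetwork w [tuple x; y]))).
  exact: measurableT_comp mf (measurable_net_class [tuple x; y]).
(* Moving the marks by [g] and the roots [x], [y] to [g x], [g y] does not change the class, and
   [nu] is invariant under [transport g]. *)
have phig g x y : phi (isoV g x) (isoV g y) = phi x y.
  rewrite /phi -[LHS](integral_aut_invariant g (mphi _ _))//; apply: eq_integral => w _.
  congr f; apply/esym/net_classP; exists g; split => //; exact: val_inj.
have out u : \int[nu]_w (let N := net_repr (net_class (RootedNetwork w [tuple u])) in
    \esum_(x in [set: vertex (ngraph N)]) f (birooted (root N) x)) =
    \esum_(x in [set: vertex G]) phi u x.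
  rewrite -integral_esum//; apply: eq_integral => w _; exact: esum_birooted_out.
have inn u : \int[nu]_w (let N := net_repr (net_class (RootedNetwork w [tuple u])) in
    \esum_(x in [set: vertex (ngraph N)]) f (birooted x (root N))) =
    \esum_(x in [set: vertex G]) phi x u.
  rewrite -integral_esum//; apply: eq_integral => w _; exact: esum_birooted_in.
have tw0 : 0 <= (total_weight haar S)^-1 by rewrite inve_ge0 (ltW total_weight_gt0).
have phi0 x y : 0 <= phi x y by exact: integral_ge0.
rewrite [LHS]muI; [|exact: measurable_vertex_sum|by move=> c; exact: esum_ge0].
rewrite [RHS]muI; [|exact: measurable_vertex_sum_in|by move=> c; exact: esum_ge0].
have scale (psi : vertex G -> vertex G -> \bar R) : (forall u x, 0 <= psi u x) ->
    \esum_(u in S) rooting_weight u * (\esum_(x in [set: vertex G]) psi u x) =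
    (total_weight haar S)^-1 * \esum_(u in S)
      (haar (@stab G u))^-1 * (\esum_(x in [set: vertex G]) psi u x).
  move=> psi0; rewrite -(esumZl cS tw0) => [|u].
    by apply: eq_esum => u _; rewrite muleA.
  by apply: mule_ge0; [exact: haar_stabV_ge0|exact: esum_ge0].
transitivity (\esum_(u in S) rooting_weight u *
    \esum_(x in [set: vertex G]) phi u x).
  apply: eq_esum => u _; case: (m_ u) => m /= [_ ->]; first by rewrite out.
    exact: measurable_vertex_sum.
  by move=> c; exact: esum_ge0.
transitivity (\esum_(u in S) rooting_weight u *
    \esum_(x in [set: vertex G]) phi x u); last first.
  apply: eq_esum => u _; case: (m_ u) => m /= [_ ->]; first by rewrite inn.
    exact: measurable_vertex_sum_in.
  by move=> c; exact: esum_ge0.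
rewrite (scale phi phi0) (scale (fun u x => phi x u) (fun u x => phi0 x u)).
by rewrite (section_mass_transport haarP rinv sectionS phi0 phig).
Qed.

End random_rooting_unimodular.

(** * Haar measure on the isomorphisms to a graph *)

Section ball_iso_limits.
Variables (G H : graph) (k : nat).
Variables (x : k.+1.-tuple (vertex G)) (y : k.+1.-tuple (vertex H)).

(** The ultrafilter refines the filter at infinity, so its members see isomorphisms of every given
    radius. Agreement with the limit on a finite set holds for ultrafilter-many [r], hence for some
    [r >= s]. *)
Lemma ball_iso_limit (aV : nat -> vertex G -> vertex H)
    (aD : nat -> dart G -> dart H) :
  (forall r, ball_iso x y r (aV r) (aD r)) ->
  exists2 f : iso G H, map_tuple (isoV f) x = y &
    forall s, exists r, [/\ (s <= r)%N, {in tball x s, aV r =1 isoV f} &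
      {in idarts (tball x s), aD r =1 isoD f}].
Proof.
move=> a_iso; have [F [UF Foo]] := @ultraFilterLemma nat \oo _.
have Fge s : F [set r | (s <= r)%N] by apply: Foo; exact: nbhs_infty_ge.
have [|f [fx fV fD]] := @ultra_iso nat F UF G H k x y aV aD.
  by move=> r; apply: filterS (Fge r) => s /= rs; exact: ball_isoW rs (a_iso s).
exists f => // s.
have [r [[/= sr hV] hD]] := filter_ex (filterI (filterI (Fge s)
  (filter_forall_finite (@ultra_proper _ _ UF) (tball_finite x s) (fun v _ => fV v)))
  (filter_forall_finite (@ultra_proper _ _ UF)
    (idarts_finite (@graph_locally_finite G) (tball_finite x s)) (fun d _ => fD d))).
by exists r; split => // v; rewrite inE; [exact: hV|exact: hD].
Qed.

Lemma ball_iso_all : (forall r, exists fV fD, ball_iso x y r fV fD) ->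
  exists f : iso G H, map_tuple (isoV f) x = y.
Proof.
move=> h; have h' r : exists fVD, ball_iso x y r fVD.1 fVD.2.
  by have [fV [fD fi]] := h r; exists (fV, fD).
have [f fx _] := ball_iso_limit (fun r => svalP (cid (h' r))).
by exists f.
Qed.

End ball_iso_limits.

(** Suppose that for every radius some ball isomorphism agrees on the [s]-ball with no automorphism
    fixing [z]. A limit of these is such an automorphism and agrees with one of them there, a
    contradiction. *)
Lemma ball_iso_extend (G : graph) k (z : k.+1.-tuple (vertex G)) s :
  exists R, forall r fV fD, (R <= r)%N -> ball_iso z z r fV fD ->
  exists2 g : aut G, map_tuple (isoV g) z = z &
    {in tball z s, fV =1 isoV g} /\ {in idarts (tball z s), fD =1 isoD g}.
Proof.
apply: contrapT => /forallNP h.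
have h' R : exists fVD, ball_iso z z R fVD.1 fVD.2 /\ ~ exists2 g : aut G,
    map_tuple (isoV g) z = z &
    {in tball z s, fVD.1 =1 isoV g} /\ {in idarts (tball z s), fVD.2 =1 isoD g}.
  have /existsNP[r /existsNP[fV /existsNP[fD]]] := h R.
  move=> /not_implyP[Rr /not_implyP[fi nog]].
  by exists (fV, fD); split => //=; exact: ball_isoW Rr fi.
have [g gz gs] := ball_iso_limit (fun R => (svalP (cid (h' R))).1).
have [r [_ hV hD]] := gs s.
by apply: (svalP (cid (h' r))).2; exists g.
Qed.

Section iso_haar.
Context {R : realType} {Xi : completeMetricType R} {G : graph}.
Variable haar : {measure set (borel (aut G)) -> \bar R}.
Hypotheses (haarP : is_haar haar) (rinv : right_invariant haar).

Definition iso_to k (z : k.-tuple (vertex G)) (N : rooted_network Xi k)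
    (A : set (marking Xi G)) : set (iso (ngraph N) G) :=
  [set f | map_tuple (isoV f) (nroots N) = z /\ A (transport f (nmark N))].

Lemma measurable_map_tuple k (x z : k.-tuple (vertex G)) :
  measurable ([set g | map_tuple (isoV g) x = z] : set (borel (aut G))).
Proof.
apply: borel_open; apply/open_autP => g /= <-; exists (range (tnth x)), set0.
split => //; first by apply: finite_image; exact: finite_finset.
by move=> h hx _; apply: eq_from_tnth => i; rewrite !tnth_map hx//; exists i.
Qed.

Lemma map_tuple_comp (T U V : Type) k (f : U -> V) (g : T -> U) (x : k.-tuple T) :
  map_tuple (f \o g) x = map_tuple f (map_tuple g x).
Proof. by apply: eq_from_tnth => i; rewrite !tnth_map. Qed.

Lemma measurable_iso_to k (z : k.-tuple (vertex G)) (N : rooted_network Xi k)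
    (f : iso (ngraph N) G) (A : set (borel (marking Xi G))) : measurable A ->
  measurable ([set g | iso_to z A (iso_comp g f)] : set (borel (aut G))).
Proof.
move=> mA; rewrite (_ : [set g | _] =
    [set g | map_tuple (isoV g) (map_tuple (isoV f) (nroots N)) = z] `&`
    (fun g => transport g (transport f (nmark N))) @^-1` A).
  apply: measurableI; first exact: measurable_map_tuple.
  by rewrite -[X in measurable X]setTI; exact: measurable_transport_aut.
by apply/seteqP; split => g [/=]; rewrite -map_tuple_comp.
Qed.

(** Restrict [haar] to the [g] for which [g f0] sends the roots to [z], and take its image under
    transport of the marks; networks not isomorphic to [G] get the zero measure. *)
Lemma iso_haar_exists k (z : k.-tuple (vertex G)) (N : rooted_network Xi k) :
  exists m : {measure set (borel (marking Xi G)) -> \bar R},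
    (forall (f : iso (ngraph N) G) A, measurable A ->
       m A = haar [set g | iso_to z A (iso_comp g f)]) /\
    (~ inhabited (iso (ngraph N) G) -> forall A, m A = 0).
Proof.
have [[f0]|nof] := pselect (inhabited (iso (ngraph N) G)); last first.
  by exists mzero; split => // f; case: nof.
have mD := measurable_map_tuple (map_tuple (isoV f0) (nroots N)) z.
have [m [mE _]] := scaled_pushforward (mrestr haar mD)
  (measurable_transport_aut (transport f0 (nmark N))) lee01 (ltry 1).
exists m; split; last by case.
have mE0 A : m A = haar [set g | iso_to z A (iso_comp g f0)].
  rewrite mE mul1e /mrestr; congr (haar _).
  by apply/seteqP; split => g [/=]; rewrite -map_tuple_comp => ? ?; split.
move=> f A mA; rewrite mE0.
(* Right translation by [f f0^-1] replaces [f0] by [f]. *)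
rewrite -(haar_compr rinv (iso_comp f (iso_inv f0)) (measurable_iso_to z f0 mA)).
congr (haar _); apply/seteqP; split => g; rewrite /= -!iso_compA iso_invKl iso_comp1//.
Qed.

Definition iso_haar k (z : k.-tuple (vertex G)) (N : rooted_network Xi k) :
  {measure set (borel (marking Xi G)) -> \bar R} :=
  sval (cid (iso_haar_exists z N)).

Lemma iso_haarE k (z : k.-tuple (vertex G)) (N : rooted_network Xi k)
    (f : iso (ngraph N) G) (A : set (borel (marking Xi G))) : measurable A ->
  iso_haar z N A = haar [set g | iso_to z A (iso_comp g f)].
Proof. by move=> mA; rewrite /iso_haar; case: cid => m [/= mE _]; exact: mE. Qed.

Lemma iso_haar0 k (z : k.-tuple (vertex G)) (N : rooted_network Xi k)
    (A : set (borel (marking Xi G))) :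
  ~ inhabited (iso (ngraph N) G) -> iso_haar z N A = 0.
Proof. by move=> nof; rewrite /iso_haar; case: cid => m [/= _]; exact. Qed.

Lemma iso_haar_iso k (z : k.-tuple (vertex G)) (N M : rooted_network Xi k)
    (A : set (borel (marking Xi G))) : measurable A ->
  network_iso N M -> iso_haar z N A = iso_haar z M A.
Proof.
move=> mA [f [fm fr]].
have [[f0]|nof] := pselect (inhabited (iso (ngraph M) G)); last first.
  rewrite !iso_haar0// => -[f0]; apply: nof.
  by constructor; exact: iso_comp f0 (iso_inv f).
rewrite (iso_haarE _ (iso_comp f0 f) mA) (iso_haarE _ f0 mA); congr (haar _).
by apply/seteqP; split => g; rewrite /iso_to /= -fr -fm -map_tuple_comp.
Qed.

(** There is at least one root, and prescribing its image confines [g] to a coset of a compact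
    stabilizer. *)
Lemma iso_haar_lty k (z : k.+1.-tuple (vertex G)) (N : rooted_network Xi k.+1) :
  iso_haar z N setT < +oo.
Proof.
have [[f]|nof] := pselect (inhabited (iso (ngraph N) G)); last first.
  by rewrite iso_haar0// ltry.
rewrite (iso_haarE _ f)//.
have [->|/set0P[g0 [gz _]]] := eqVneq [set g | iso_to z setT (iso_comp g f)] set0.
  by rewrite measure0 ltry.
pose x := isoV f (tnth (nroots N) ord0).
apply: le_lt_trans (haar_stab_lty haarP x); rewrite -(haar_isoV_left haarP g0).
apply: le_measure; rewrite ?inE; [exact: measurable_iso_to|exact: measurable_isoV|].
move=> g [/(congr1 (fun t => tnth t ord0))]; rewrite -gz !tnth_map /=.
by move=> -> _.
Qed.

End iso_haar.

(** * Semicontinuity and measurability of the Haar measure on isomorphisms *)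

Section iso_haar_measurability.
Context {R : realType} {Xi : completeMetricType R} {G : graph}.
Variable haar : {measure set (borel (aut G)) -> \bar R}.
Hypotheses (haarP : is_haar haar) (rinv : right_invariant haar).
Context {k : nat}.
Variable z : k.+1.-tuple (vertex G).
Local Notation mstar := (iso_haar rinv z).
Local Notation net w := (RootedNetwork w z).

Let stabz : set (aut G) := [set g | map_tuple (isoV g) z = z].

Lemma iso_haar_netE (w : marking Xi G) (A : set (borel (marking Xi G))) :
  measurable A ->
  mstar (net w) A = haar (stabz `&` [set g | A (transport g w)]).
Proof.
by move=> mA; rewrite (iso_haarE rinv z (iso_id G : iso (ngraph (net w)) G) mA).
Qed.

(** As [A] is open, each [g] with [transport g w] in [A] keeps this property under perturbations of
    [g] and [w] of a size depending on [g]. Continuity of [haar] from below yields one size that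
    works for a set of measure above [t]. *)
Lemma iso_haar_net_lsc (w : marking Xi G) (A : set (marking Xi G)) (t : R) :
  open A -> t%:E < mstar (net w) A ->
  exists s e, (0 < e)%R /\ forall w',
    mark_close (tball z s) (idarts (tball z s)) e w w' -> t%:E < mstar (net w') A.
Proof.
move=> oA; have mA := borel_open oA; rewrite iso_haar_netE// => tw.
pose e n : R := (n.+1%:R^-1)%R.
pose agree n (g h : aut G) := {in tball z n, isoV h =1 isoV g} /\
  {in idarts (tball z n), isoD h =1 isoD g}.
pose close n w' := mark_close (tball z n) (idarts (tball z n)) (e n) w w'.
(* [O n] is open since its condition only depends on [g] restricted to the
   ball of radius [n], and the [O n] increase to the set of [g] in question. *)
pose O n := [set g : aut G | stabz g /\ forall h w', stabz h -> agree n g h ->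
  close n w' -> A (transport h w')].
have zn n i : tnth z i \in tball z n by rewrite inE; apply: gball_sub; exists i.
have agree_stab n g h : agree n g h -> stabz g -> stabz h.
  move=> [gV _] gz; rewrite /stabz /= -[RHS]gz.
  by apply: eq_from_tnth => i; rewrite !tnth_map gV.
have oO n : open (O n).
  apply/open_autP => g [gz gO]; exists (tball z n), (idarts (tball z n)); split.
  - exact: tball_finite.
  - by apply: idarts_finite (tball_finite _ _); exact: graph_locally_finite.
  move=> h hV hD; have gh : agree n g h.
    by split=> x; rewrite inE => xn; [exact: hV|exact: hD].
  split; first exact: agree_stab gh gz.
  move=> h' w' h'z [h'V h'D]; apply: gO => //.
  by split => x xn; [rewrite h'V// gh.1|rewrite h'D// gh.2].
have Ondecr : {homo O : n m / (n <= m)%N >-> (n <= m)%O}.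
  move=> n m nm; apply/subsetPset => g [gz gO]; split => // h w' hz [hV hD] ww'.
  have tnm : tball z n `<=` tball z m by exact: gballS.
  apply: gO => //.
    by split => x; rewrite inE => xn; [apply: hV|apply: hD]; rewrite inE;
      [exact: tnm|exact: idartsS tnm _ _].
  apply: mark_closeS ww' => //; first exact: idartsS.
  by rewrite /e lef_pV2 ?posrE// ler_nat ltnS.
have OE : \bigcup_n O n = stabz `&` [set g | A (transport g w)].
  apply/seteqP; split => [g [n _ [gz gO]]|g [gz gA]].
    split => //; apply: gO => //; split => x _; by rewrite mdistxx invr_gt0.
  have /open_markingP/(_ _ gA)[B [C [d [fB fC d0 hA]]]] := oA.
  (* The marks tested by [hA] sit on [w] at the preimages of [B] and [C] under [g]; a large ball
     around [z] contains them. *)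
  pose Q (x : vertex G) r (e' : R) := tball z r (isoV_inv g x).
  have [|||r1 [d1 [_ hr1]]] := @finite_uniform R _ B Q.
  - exact: fB.
  - by move=> x r r' ? ? rr _; exact: gballS.
  - by move=> x _; have [r xr] := tball_cover z (isoV_inv g x); exists r, 1%R.
  pose Q' (x : dart G) r (e' : R) := idarts (tball z r) (isoD_inv g x).
  have [|||r2 [d2 [_ hr2]]] := @finite_uniform R _ C Q'.
  - exact: fC.
  - by move=> x r r' ? ? rr _; apply: idartsS; exact: gballS.
  - by move=> x _; have [r xr] := idarts_tball_cover z (isoD_inv g x); exists r, 1%R.
  have [r3 hr3] : exists r3 : nat, (r3.+1%:R^-1 < d)%R.
    by exists (Num.trunc d^-1); rewrite invf_plt ?posrE// truncnS_gt.
  (* The ball of radius [n] contains the preimages of [B] and [C], and the tolerance [e n] is at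
     most [d]. *)
  pose n := maxn (maxn r1 r2) r3; exists n => //; split => // h w' hz [hV hD] [wV wD].
  have r1n : tball z r1 `<=` tball z n.
    by apply: (@gballS _ _ r1 n); exact: leq_trans (leq_maxl r1 r2) (leq_maxl _ r3).
  have r2n : idarts (tball z r2) `<=` idarts (tball z n).
    apply: idartsS; apply: (@gballS _ _ r2 n).
    exact: leq_trans (leq_maxr r1 r2) (leq_maxl _ r3).
  have en : (e n <= d)%R.
    apply: le_trans (ltW hr3); rewrite /e lef_pV2 ?posrE// ler_nat ltnS.
    exact: leq_maxr.
  have hVg x : B x -> isoV_inv h x = isoV_inv g x.
    by apply: isoV_inv_agree => _ [y /hr1 yr <-]; apply: hV; rewrite inE; exact: r1n.
  have hDg x : C x -> isoD_inv h x = isoD_inv g x.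
    by apply: isoD_inv_agree => _ [y /hr2 yr <-]; apply: hD; rewrite inE; exact: r2n.
  apply: hA; split => x xB; rewrite /transport /vmark /dmark /= ?hVg ?hDg//.
    by apply: lt_le_trans en; apply: wV; exact/r1n/hr1.
  by apply: lt_le_trans en; apply: wD; exact/r2n/hr2.
have mO n : measurable (O n : set (borel (aut G))) by exact: borel_open.
have := @nondecreasing_cvg_mu _ (borel (aut G)) _ haar O mO
  (@bigcupT_measurable _ (borel (aut G)) O mO) Ondecr.
rewrite OE => /cvg_lim Olim.
have [n tOn] : exists n, t%:E < haar (O n).
  apply: contrapT => /forallNP noO; move: tw; rewrite ltNge => /negP; apply.
  rewrite -(Olim (@ereal_hausdorff R)); apply: lime_le.
    apply: ereal_nondecreasing_is_cvgn => n m nm.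
    by apply: le_measure; rewrite ?inE//; apply/subsetPset/Ondecr.
  by apply: nearW => n /=; rewrite leNgt; apply/negP; exact: noO.
exists n, (e n); split; first by rewrite /e invr_gt0.
move=> w' ww'; rewrite iso_haar_netE//; apply: lt_le_trans tOn _.
apply: le_measure; rewrite ?inE//.
  apply: measurableI; first exact: measurable_map_tuple.
  by rewrite -[X in measurable X]setTI; exact: measurable_transport_aut.
by move=> g [gz gO]; split => //; apply: gO.
Qed.

(** The classes of the networks that some isomorphism to [G] roots at [z]; [mstar] vanishes
    elsewhere. *)
Let E : set (net_space Xi k.+1) := range (fun w => net_class (net w)).

(** If every neighbourhood of [N] meets [E], each ball of [N] is isomorphic to the ball of the same
    radius around [z], and [ball_iso_all] provides a global isomorphism. The tolerance [1] on the
    marks is arbitrary. *)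
Lemma closed_range_net : open (~` E).
Proof.
apply/open_netP => N /= NE; apply: contrapT => /forallNP h; apply: NE.
suff [f fz] : exists f : iso (ngraph N) G, map_tuple (isoV f) (nroots N) = z.
  exists (transport f (nmark N)) => //.
  by apply/esym/net_classP; exists f.
apply: ball_iso_all => r; have /forallNP/(_ 1%R)/not_andP[//|] := h r.
move=> /existsNP[M /not_implyP[NM /contrapT [w _ /esym/net_classP[f [_ fz]]]]].
have /locally_closeP[fV [fD [fi _ _]]] := NM.
exists (isoV f \o fV), (isoD f \o fD); apply: ball_iso_comp fi _.
by have := iso_ball_iso f (nroots M) r; rewrite fz.
Qed.

Lemma iso_haar_rebase (N : rooted_network Xi k.+1) (f : iso (ngraph N) G)
    (A : set (borel (marking Xi G))) : measurable A ->
  map_tuple (isoV f) (nroots N) = z ->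
  mstar N A = mstar (net (transport f (nmark N))) A.
Proof. by move=> mA fz; apply: iso_haar_iso => //; exists f. Qed.

Lemma iso_haar_gt0 (N : rooted_network Xi k.+1) (A : set (borel (marking Xi G))) :
  measurable A -> 0 < mstar N A ->
  exists f : iso (ngraph N) G, map_tuple (isoV f) (nroots N) = z.
Proof.
move=> mA; have [[f]|nof] := pselect (inhabited (iso (ngraph N) G)); last first.
  by rewrite iso_haar0// ltxx.
rewrite (iso_haarE rinv z f mA).
have [->|/set0P[g [gz _]] _] := eqVneq [set g | iso_to z A (iso_comp g f)] set0.
  by rewrite measure0 ltxx.
by exists (iso_comp g f).
Qed.

(* If [M] is close to [(G, w, z)] and isomorphic to [(G, w', z)], then the
   ball isomorphism agrees on a smaller ball with an automorphism [g] fixing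
   [z], and [w'] moved by [g^-1] is close to [w]. *)
Lemma open_iso_haar_gt (A : set (marking Xi G)) (t : R) : open A -> (0 <= t)%R ->
  open ([set c | t%:E < mstar (net_repr c) A] `|` ~` E).
Proof.
move=> oA t0; have mA := borel_open oA.
have reprE N : mstar (net_repr (net_class N)) A = mstar N A.
  by apply: iso_haar_iso => //; apply/net_classP; rewrite net_reprK.
apply/open_netP => N [|NE]; last first.
  have /open_netP/(_ N NE)[r [e [e0 h]]] := closed_range_net.
  by exists r, e; split => // M /h; right.
rewrite /= reprE => tN.
(* As [0 <= t], the measure of [A] is positive, so some isomorphism carries the roots to [z]. *)
have [f fz] : exists f : iso (ngraph N) G, map_tuple (isoV f) (nroots N) = z.
  by apply: iso_haar_gt0 mA _; apply: le_lt_trans tN; rewrite lee_fin.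
move: tN; rewrite (iso_haar_rebase mA fz) => /(iso_haar_net_lsc oA)[s [e [e0 hs]]].
have [r hr] := ball_iso_extend z s.
(* Radius [r] lets the ball isomorphism extend to an automorphism, and radius [s] controls the marks
   that [hs] compares. *)
exists (maxn r s), e; split => // M /locally_closeP[fV [fD [fi hV hD]]].
have [[w _ /esym/net_classP[p0 [_ pz0]]]|] := pselect (E (net_class M)); last by right.
left; rewrite /= reprE; pose p : iso (ngraph M) G := p0.
have pz : map_tuple (isoV p) (nroots M) = z := pz0.
pose f' := iso_inv f.
have f'z : map_tuple (isoV f') z = nroots N.
  by apply: eq_from_tnth => i; rewrite -fz !tnth_map /= isoVK.
have f'i : ball_iso z (nroots N) (maxn r s) (isoV f') (isoD f').
  by rewrite -f'z; exact: iso_ball_iso.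
have pi : ball_iso (nroots M) z (maxn r s) (isoV p) (isoD p).
  by have := iso_ball_iso p (nroots M) (maxn r s); rewrite pz.
have [g gz [gV gD]] := hr _ _ _ (leq_maxl _ _) (ball_iso_comp (ball_iso_comp f'i fi) pi).
have pgz : map_tuple (isoV (iso_comp (iso_inv g) p)) (nroots M) = z.
  apply: eq_from_tnth => i; rewrite tnth_map /=.
  have -> : isoV p (tnth (nroots M) i) = isoV g (tnth z i).
    have := congr1 (fun x => tnth x i) (etrans pz (esym gz)).
    by rewrite !tnth_map.
  exact: isoVK.
rewrite (iso_haar_rebase mA pgz); apply: hs.
have zs : tball z s `<=` tball z (maxn r s) by apply: gballS; exact: leq_maxr.
have f'V x : tball z s x -> tball (nroots N) (maxn r s) (isoV f' x).
  by move=> /zs xz; have [[[+ _ _] _ _] _] := f'i; apply.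
have f'D d : idarts (tball z s) d -> idarts (tball (nroots N) (maxn r s)) (isoD f' d).
  by move=> /(idartsS zs) xz; have [[_ [+ _ _] _] _] := f'i; apply.
split => x xs; rewrite /transport /vmark /dmark /=.
  by rewrite -gV ?inE//= isoVK; exact: hV (f'V _ xs).
by rewrite -gD ?inE//= isoDK; exact: hD (f'D _ xs).
Qed.

(** For [0 <= t] the superlevel set on an open set is an open set intersected with the closed set
    [E]; for negative [t] it is everything. *)
Lemma measurable_iso_haar (A : set (borel (marking Xi G))) : measurable A ->
  measurable_fun setT (fun c : borel (net_space Xi k.+1) => mstar (net_repr c) A).
Proof.
move: A; apply: borel_kernel_measurable => [c|A oA]; first exact: iso_haar_lty.
apply: borel_lsc_measurable => t; have [t0|t0] := leP 0%R t; last first.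
  rewrite (_ : [set _ | _] = setT)//; apply/seteqP; split => // c _ /=.
  by apply: lt_le_trans (measure_ge0 _ _); rewrite lte_fin.
rewrite (_ : [set _ | _] = ([set c | t%:E < mstar (net_repr c) A] `|` ~` E) `&` ~` ~` E).
  apply: measurableI; first by apply: borel_open; exact: open_iso_haar_gt.
  by apply: measurableC; apply: borel_open; exact: closed_range_net.
apply/seteqP; split => [c tc|c [[//|cE]]]; last by case.
split; [by left|rewrite setCK].
have [|f fz] := @iso_haar_gt0 (net_repr c) A (borel_open oA).
  by apply: le_lt_trans tc; rewrite lee_fin.
exists (transport f (nmark (net_repr c))) => //.
by rewrite -[RHS]net_reprK; apply/esym/net_classP; exists f.
Qed.

End iso_haar_measurability.

(** * Invariance of lambda_mu *)

Section kernel_integral.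
Context d d' (X : measurableType d) (Y : measurableType d') (R : realType).
Variables (mu : {measure set X -> \bar R}) (k : X -> {measure set Y -> \bar R}).
Hypothesis mk : forall A, measurable A -> measurable_fun setT (fun x => k x A).

(** The measurability proof is carried as an argument so that the measure instance below can find
    it. *)
Definition kernel_integral of (forall A, measurable A ->
    measurable_fun setT (fun x => k x A)) : set Y -> \bar R :=
  fun A => \int[mu]_x k x A.

Let mkm := kernel_integral mk.

Let kernel_integral0 : mkm set0 = 0.
Proof.
rewrite /mkm /kernel_integral; under eq_integral do rewrite measure0.
exact: integral0.
Qed.

Let kernel_integral_ge0 A : 0 <= mkm A.
Proof. exact: integral_ge0. Qed.

Let kernel_integral_sigma_additive : semi_sigma_additive mkm.
Proof.
move=> F mF tF mUF.
rewrite [X in _ --> X](_ : _ = \sum_(n <oo) mkm (F n)).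
  by apply: is_cvg_ereal_nneg_natsum => n _; exact: integral_ge0.
rewrite /mkm /kernel_integral -integral_nneseries//; last by move=> n; exact: mk.
by apply: eq_integral => x _; rewrite measure_semi_bigcup.
Qed.

HB.instance Definition _ := isMeasure.Build _ _ _ mkm
  kernel_integral0 kernel_integral_ge0 kernel_integral_sigma_additive.

End kernel_integral.

Section lambda_mu_invariant.
Context {R : realType} {Xi : completeMetricType R} {G : graph}.
Variable haar : {measure set (borel (aut G)) -> \bar R}.
Hypotheses (haarP : is_haar haar) (rinv : right_invariant haar).
Implicit Types (u v : vertex G) (A : set (borel (marking Xi G))).

Lemma iso_to1 (N : rooted_network Xi 1) u A (f : iso (ngraph N) G) :
  iso_to [tuple u] A f <-> isoV f (root N) = u /\ A (transport f (nmark N)).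
Proof.
rewrite /iso_to /= nroots_root; split => -[h ?]; split => //.
  by have := congr1 (fun t => tnth t ord0) h; rewrite tnth_map.
by apply: val_inj; rewrite /= h.
Qed.

Lemma iso_haar_netr k (z : k.-tuple (vertex G)) (N : rooted_network Xi k) A :
  measurable A -> iso_haar rinv z (net_repr (net_class N)) A = iso_haar rinv z N A.
Proof. by move=> mA; apply: iso_haar_iso => //; apply/net_classP; rewrite net_reprK. Qed.

Lemma iso_to2 (N : rooted_network Xi 1) (x y : vertex (ngraph N)) u v A
    (f : iso (ngraph N) G) :
  iso_to [tuple u; v] (N := RootedNetwork (nmark N) [tuple x; y]) A f <->
  [/\ isoV f x = u, isoV f y = v & A (transport f (nmark N))].
Proof.
rewrite /iso_to /=; split => [[h ?]|[h1 h2 ?]].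
  split => //; first by have := congr1 (fun t => tnth t ord0) h; rewrite tnth_map.
  by have := congr1 (fun t => tnth t (lift ord0 ord0)) h; rewrite tnth_map.
by split => //; apply: val_inj; rewrite /= h1 h2.
Qed.

(** Each isomorphism [f] sends exactly one [x] to [v], so summing over [x] removes the condition on
    the second root. *)
Lemma esum_iso_haar_out (N : rooted_network Xi 1) u v A : measurable A ->
  \esum_(x in [set: vertex (ngraph N)])
    iso_haar rinv [tuple u; v] (net_repr (birooted (root N) x)) A =
  iso_haar rinv [tuple u] N A.
Proof.
move=> mA; have [[f]|nof] := pselect (inhabited (iso (ngraph N) G)); last first.
  by rewrite iso_haar0// esum1// => x _; rewrite iso_haar_netr// iso_haar0.
rewrite (iso_haarE rinv [tuple u] f mA).
rewrite -(esum_haar_source haar v (measurable_iso_to _ _ mA)).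
rewrite (reindex_esum _ _ _ _ (iso_bij_vertex f)); apply: eq_esum => x _.
rewrite iso_haar_netr//.
rewrite (iso_haarE rinv [tuple u; v]
  (f : iso (ngraph (RootedNetwork (nmark N) _)) G) mA).
congr (haar _); apply/seteqP; split => g /=.
  by move=> /iso_to2[h1 h2 h3]; split => //; exact/iso_to1.
by move=> [/iso_to1[h1 h2] h3]; exact/iso_to2.
Qed.

Lemma esum_iso_haar_in (N : rooted_network Xi 1) u v A : measurable A ->
  \esum_(x in [set: vertex (ngraph N)])
    iso_haar rinv [tuple u; v] (net_repr (birooted x (root N))) A =
  iso_haar rinv [tuple v] N A.
Proof.
move=> mA; have [[f]|nof] := pselect (inhabited (iso (ngraph N) G)); last first.
  by rewrite iso_haar0// esum1// => x _; rewrite iso_haar_netr// iso_haar0.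
rewrite (iso_haarE rinv [tuple v] f mA).
rewrite -(esum_haar_source haar u (measurable_iso_to _ _ mA)).
rewrite (reindex_esum _ _ _ _ (iso_bij_vertex f)); apply: eq_esum => x _.
rewrite iso_haar_netr//.
rewrite (iso_haarE rinv [tuple u; v]
  (f : iso (ngraph (RootedNetwork (nmark N) _)) G) mA).
congr (haar _); apply/seteqP; split => g /=.
  by move=> /iso_to2[h1 h2 h3]; split => //; exact/iso_to1.
by move=> [/iso_to1[h1 h2] h3]; exact/iso_to2.
Qed.

(** Mass transport of the measure of the isomorphisms sending the two roots to [u] and [v]: the
    outgoing sum retains [u], the incoming one [v]. *)
Lemma integral_iso_haar_root (mu : {measure set (borel (Gstar Xi)) -> \bar R}) u v A :
  unimodular_measure mu -> measurable A ->
  \int[mu]_c iso_haar rinv [tuple u] (net_repr c) A =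
  \int[mu]_c iso_haar rinv [tuple v] (net_repr c) A.
Proof.
move=> umu mA.
have := umu (fun c => iso_haar rinv [tuple u; v] (net_repr c) A)
  (measurable_iso_haar haarP rinv [tuple u; v] mA) (fun c => measure_ge0 _ _).
by under eq_integral do rewrite /= esum_iso_haar_out//;
  under [RHS]eq_integral do rewrite /= esum_iso_haar_in//.
Qed.

(** Left invariance allows the substitution of [g h] for [h], which moves the target [u] of the root
    to [g u]. *)
Lemma iso_haar_transport (N : rooted_network Xi 1) (g : aut G) u A : measurable A ->
  iso_haar rinv [tuple u] N (transport g @^-1` A) = iso_haar rinv [tuple isoV g u] N A.
Proof.
move=> mA; have mgA : measurable (transport g @^-1` A : set (borel (marking Xi G))).
  by rewrite -[X in measurable X]setTI; exact: measurable_transport.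
have [[f]|nof] := pselect (inhabited (iso (ngraph N) G)); last by rewrite !iso_haar0.
rewrite (iso_haarE rinv [tuple u] f mgA) (iso_haarE rinv [tuple isoV g u] f mA).
rewrite -(haar_compl haarP g (measurable_iso_to _ _ mA)); congr (haar _).
apply/seteqP; split => h /= /iso_to1[hu hA]; apply/iso_to1; split => //=.
  by rewrite -hu.
by have /= := congr1 (isoV_inv g) hu; rewrite !isoVK.
Qed.

Variable S : set (vertex G).
Hypothesis sectionS : complete_section S.

(** Both sums reduce to the single term at the representative [u] of the orbit to which isomorphisms
    send the root. *)
Lemma lambda_iso_haar (N : rooted_network Xi 1) A : measurable A ->
  lambda_ haar (root N) (Phi (root N) (tau S (root N)) `&`
    [set f | A (transport f (nmark N))]) =
  \esum_(u in S) (haar (@stab G u))^-1 * iso_haar rinv [tuple u] N A.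
Proof.
move=> mA; have [[f0]|nof] := pselect (inhabited (iso (ngraph N) G)); last first.
  rewrite [RHS]esum1 => [|u _]; last by rewrite iso_haar0// mule0.
  apply: esum1 => u _; rewrite /lambda'; case: pselect => // -[f ff].
  by case: nof; constructor.
have [u [[Su [g gu]] uu]] := sectionS (isoV f0 (root N)).
have uniq_u u' (f : iso (ngraph N) G) : S u' -> isoV f (root N) = u' -> u' = u.
  move=> Su' fu'; apply/esym/uu; split => //.
  by exists (iso_comp f (iso_inv f0)); rewrite /= isoVK.
have tauE : tau S (root N) = u.
  rewrite /tau; case: xgetP => [u' -> [Su' [f fu']]|/(_ u)[]].
    exact: uniq_u Su' fu'.
  by split => //; exists (iso_comp g f0).
rewrite tauE [RHS](esum_single Su).
- rewrite /lambda_ (esum_single (i := u))//.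
  + rewrite /lambda'; case: pselect => [ne|ne]; last by case: ne; exists (iso_comp g f0).
    case: (cid ne) => f fu /=; rewrite /stab_haar; congr (_ * _).
    (* [iso_haar] can be computed from any isomorphism, in particular from the one chosen in
       [lambda']. *)
    rewrite (iso_haarE rinv [tuple u] f mA); congr (haar _).
    apply/seteqP; split => h /=; first by move=> [hA _]; exact/iso_to1.
    move=> /iso_to1[hu hA]; split; first by split.
    by rewrite /stab /= -[in LHS]fu.
  + move=> v _; rewrite /lambda'; case: pselect => // ne.
    by rewrite /stab_haar mule_ge0 ?haar_stabV_ge0.
  (* The measure [stab_haar v] lives on the [h] fixing [v]; then [h f] sends the root to [v], hence
     lies outside [Phi u]. *)
  + move=> v _ vu; rewrite /lambda'; case: pselect => // ne.
    case: (cid ne) => f fv /=.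
    rewrite /stab_haar (_ : _ `&` _ = set0) ?measure0 ?mule0//.
    apply/seteqP; split => // h [[/= hu _] hv]; apply: vu.
    by rewrite -hu -hv /Phi /= fv.
- by move=> v Sv; rewrite mule_ge0 ?haar_stabV_ge0.
- move=> v Sv vu; rewrite (iso_haarE rinv [tuple v] f0 mA).
  rewrite (_ : [set _ | _] = set0) ?measure0 ?mule0//.
  by apply/seteqP; split => // h /iso_to1[hv _]; apply: vu; exact: uniq_u Sv hv.
Qed.

Lemma lambda_mu_measure (mu : probability (borel (Gstar Xi)) R) :
  unimodular_measure mu ->
  exists lam : {measure set (borel (marking Xi G)) -> \bar R},
    (forall A, measurable A -> lam A = lambda_mu haar S mu A) /\
    aut_invariant lam.
Proof.
move=> umu.
have w0 u : 0 <= (haar (@stab G u))^-1 by exact: haar_stabV_ge0.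
have woo u : (haar (@stab G u))^-1 < +oo.
  have h0 := haar_stab_gt0 haarP u.
  by rewrite -ge0_fin_numE// fin_numV ?(gt_eqF h0)// gt_eqF// (lt_trans _ h0).
have mk u (A : set (borel (marking Xi G))) : measurable A ->
    measurable_fun setT
      (fun c : borel (Gstar Xi) => iso_haar rinv [tuple u] (net_repr c) A).
  exact: measurable_iso_haar.
(* The image under the identity only scales the measure by the weight of [u]. *)
have m_ u := cid (scaled_pushforward (kernel_integral mu (mk u))
  (@measurable_id _ (borel (marking Xi G)) setT) (w0 u) (woo u)).
have cS : countable S.
  by apply: sub_countable (@countable_vertex G); exact: subset_card_le.
have [lam [lamE _]] := esum_measure cS (fun u => sval (m_ u)).
have lamE' A : lam A = \esum_(u in S) (haar (@stab G u))^-1 *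
    \int[mu]_c iso_haar rinv [tuple u] (net_repr c) A.
  rewrite lamE; apply: eq_esum => u _.
  by case: (m_ u) => m /= [-> _]; rewrite preimage_id.
exists lam; split => [A mA|g A mA].
  rewrite lamE' /lambda_mu; under [RHS]eq_integral do rewrite /= lambda_iso_haar//.
  rewrite integral_esum//.
  - apply: eq_esum => u _; rewrite ge0_integralZl//; exact: (mk _ _ mA).
  - by move=> u; apply: measurable_funeM; exact: (mk _ _ mA).
  - by move=> u c; rewrite mule_ge0.
rewrite !lamE'; apply: eq_esum => u _; congr (_ * _).
(* The preimage under [transport g] moves [u] to [g u], and the integral over [mu] does not depend
   on that vertex. *)
under eq_integral do rewrite iso_haar_transport//.
exact: integral_iso_haar_root.
Qed.

End lambda_mu_invariant.

Theorem theorem3p2 (R : realType) (Xi : completeMetricType R)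
    (sepXi : separable Xi) (G : graph)
    (haar : {measure set (borel (aut G)) -> \bar R}) (haarP : is_haar haar)
    (unimodG : unimodular_graph R G)
    (S : set (vertex G)) (sectionS : complete_section S)
    (finite_weight : total_weight haar S < +oo) :
  (forall nu : probability (borel (marking Xi G)) R,
     aut_invariant nu ->
     exists mu : probability (borel (Gstar Xi)) R,
       (forall B, measurable B -> mu B = random_rooting haar S nu B) /\
       unimodular_measure mu) /\
  (forall mu : probability (borel (Gstar Xi)) R,
     unimodular_measure mu -> supported_on G mu ->
     exists lam : {measure set (borel (marking Xi G)) -> \bar R},
       (forall A, measurable A -> lam A = lambda_mu haar S mu A) /\
       aut_invariant lam).
Proof.
have rinv : right_invariant haar := unimodG haar haarP.
split=> [nu nu_inv|mu umu _]; first exact: random_rooting_unimodular.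
exact: lambda_mu_measure.
Qed.
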